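(* Let $\mu$ be a Borel probability measure on $\mathbb{R}^d$ such that there is a bounded connected open Lipschitz domain $\Omega\subset B(0,1)$ with $\mu(dx)=\rho_\mu(x)\mathbf 1_\Omega(x)dx$ and constants $0<\underline\lambda_\mu\le\overline\lambda_\mu<\infty$ with $\underline\lambda_\mu\le\rho_\mu\le\overline\lambda_\mu$ a.e. on $\Omega$. Let $\nu$ be a probability measure such that the Monge map from $\mu$ to $\nu$ for the cost $c(x,y)=\frac12\|x-y\|^2$ is affine: $T(x)=Ax+a$ with $A$ symmetric positive definite and $a\in\mathbb{R}^d$. Let $\mu_A\coloneqq(A^{1/2})_\#\mu$ and $\Omega_A\coloneqq A^{1/2}\Omega$. Fix any $r_A>0$ and define $$\kappa_A\coloneqq\inf_{u\in\operatorname{spt}\mu_A}\ \inf_{0<r\le r_A}\frac{\mathrm{Leb}(\Omega_A\cap B(u,r))}{\omega_dr^d},\qquad \underline\lambda_{\mu_A}\coloneqq\frac{\underline\lambda_\mu}{\sqrt{\det A}},$$ and $\varepsilon_0\coloneqq\underline\lambda_{\mu_A}\kappa_A\omega_dr_A^{d+2}$. Then for all $\varepsilon\in(0,\varepsilon_0]$, $$\sup_{(x,y)\in\operatorname{spt}\pi_\varepsilon}\|y-T(x)\|\le 8\sqrt{\lambda_{\max}(A)}\left(\frac{\varepsilon}{\underline\lambda_{\mu_A}\kappa_A\omega_d}\right)^{\frac{1}{d+2}}=8\sqrt{\lambda_{\max}(A)}\left(\frac{\sqrt{\det A}\,\Gamma(\frac d2+1)}{\underline\lambda_\mu\kappa_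A\pi^{d/2}}\right)^{\frac1{d+2}}\varepsilon^{\frac1{d+2}}.$$
   Context: $P=\mu\otimes\nu$; for $\varepsilon>0$, $\pi_\varepsilon$ is the unique minimizer of $\int c\,d\pi+\frac\varepsilon2\|\frac{d\pi}{dP}\|^2_{L^2(P)}$ over couplings $\pi\in\Pi(\mu,\nu)$ with $\pi\ll P$. $B(u,r)$ is the closed Euclidean ball, $\omega_d=\pi^{d/2}/\Gamma(\frac d2+1)$ its unit volume, $\lambda_{\max}(A)$ the largest eigenvalue of $A$, $\operatorname{spt}$ the support, and $F_\#\mu$ the pushforward. *)

(* Defs.v *)
(* R^d is modelled as row vectors 'rV[R]_n.+1
   (so d = n.+1 >= 1), equipped with its Borel sigma-algebra. *)
From HB Require Import structures.
From mathcomp Require Import all_boot all_order all_algebra.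
From mathcomp Require Import all_classical all_reals all_analysis.
Import Order.TTheory GRing.Theory Num.Theory numFieldNormedType.Exports.

Set Implicit Arguments.
Unset Strict Implicit.
Unset Printing Implicit Defensive.

Local Open Scope classical_set_scope.
Local Open Scope ring_scope.

Definition enorm {R : realType} {m : nat} (x : 'rV[R]_m) : R :=
  Num.sqrt (\sum_(i < m) x 0 i ^+ 2).

Definition eball {R : realType} {m : nat} (u : 'rV[R]_m) (r : R) : set 'rV[R]_m :=
  [set x | enorm (x - u) <= r].

Definition Rd (R : realType) (n : nat) :=
  g_sigma_algebraType [set A : set 'rV[R]_n.+1 | open A].

(* Lebesgue measure on R^d: a measure on the Borel sets giving every closed
   box its volume (this determines it uniquely). *)
Definition is_lebesgue {R : realType} {n : nat} (leb : set (Rd R n) -> \bar R) :=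
  forall a b : 'rV[R]_n.+1,
    leb [set x : Rd R n | forall i, a 0 i <= x 0 i <= b 0 i] =
    (\prod_(i < n.+1) Num.max (b 0 i - a 0 i) 0)%:E.

Definition Gamma {R : realType} (s : R) : R :=
  fine (\int[@lebesgue_measure R]_(t in `]0%R, +oo[%classic)
          (powR t (s - 1) * expR (- t))%:E)%E.

(* omega_d = pi^{d/2} / Gamma(d/2 + 1), volume of the unit ball. *)
Definition omega {R : realType} (d : nat) : R :=
  powR pi (d%:R / 2) / Gamma (d%:R / 2 + 1).

Definition boundary_pt {R : realType} {m : nat} (O : set 'rV[R]_m) (p : 'rV[R]_m) :=
  forall r : R, 0 < r ->
    (exists x, O x /\ enorm (x - p) < r) /\ (exists x, ~ O x /\ enorm (x - p) < r).

(* Lipschitz domain: near each boundary point, after a rigid rotation Q,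
   the set is the strict subgraph (in the first coordinate) of a Lipschitz
   function of the remaining n coordinates. *)
Definition lipschitz_domain {R : realType} {n : nat} (O : set 'rV[R]_n.+1) :=
  forall p, boundary_pt O p ->
    exists r : R, 0 < r /\
    exists (Q : 'M[R]_n.+1) (g : 'rV[R]_n -> R) (L : R),
      Q^T *m Q = 1%:M /\
      (forall u v, `|g u - g v| <= L * enorm (u - v)) /\
      (forall x, enorm (x - p) < r ->
         (O x <-> ((x - p) *m Q) 0 0 <
                  g (\row_(i < n) ((x - p) *m Q) 0 (lift ord0 i)))).

Definition sym_posdef {R : realType} {m : nat} (A : 'M[R]_m) :=
  A^T = A /\ forall v : 'rV[R]_m, v != 0 -> 0 < (v *m A *m v^T) 0 0.

Definition lambda_max {R : realType} {m : nat} (A : 'M[R]_m) : R :=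
  sup [set x : R | eigenvalue A x].

Definition push {T U : Type} {R : realType} (m : set T -> \bar R) (f : T -> U) :
  set U -> \bar R := fun E => m (f @^-1` E).

Definition spt {R : realType} {n : nat} (m : set (Rd R n) -> \bar R) : set 'rV[R]_n.+1 :=
  [set u | forall r : R, 0 < r -> (0 < m (eball u r))%E].

(* Support of a measure on R^d x R^d (products of balls form a base). *)
Definition spt2 {R : realType} {n : nat} (m : set (Rd R n * Rd R n) -> \bar R) :
  set ('rV[R]_n.+1 * 'rV[R]_n.+1) :=
  [set z | forall r : R, 0 < r -> (0 < m (eball z.1 r `*` eball z.2 r))%E].

Definition cost {R : realType} {n : nat} (z : Rd R n * Rd R n) : R :=
  enorm (z.1 - z.2) ^+ 2 / 2.

Definition is_coupling {R : realType} {n : nat} (mu nu : set (Rd R n) -> \bar R)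
  (pi : set (Rd R n * Rd R n) -> \bar R) :=
  forall A : set (Rd R n), measurable A ->
    pi (A `*` setT) = mu A /\ pi (setT `*` A) = nu A.

Definition has_density {R : realType} {n : nat}
  (P pi : set (Rd R n * Rd R n) -> \bar R) (f : Rd R n * Rd R n -> R) :=
  measurable_fun setT f /\ (forall z, 0 <= f z) /\
  forall E, measurable E -> pi E = (\int[P]_(z in E) (f z)%:E)%E.

Definition reg_objective {R : realType} {n : nat} (eps : R)
  (P pi : set (Rd R n * Rd R n) -> \bar R) (f : Rd R n * Rd R n -> R) : \bar R :=
  (\int[pi]_z (cost z)%:E + (eps / 2)%:E * \int[P]_z ((f z) ^+ 2)%:E)%E.

Definition is_reg_ot_plan {R : realType} {n : nat} (mu nu : probability (Rd R n) R)
  (eps : R) (pi : {measure set (Rd R n * Rd R n) -> \bar R}) :=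
  is_coupling mu nu pi /\
  exists f, has_density (mu \x nu)%E pi f /\
    forall (pi' : {measure set (Rd R n * Rd R n) -> \bar R}) f',
      is_coupling mu nu pi' -> has_density (mu \x nu)%E pi' f' ->
      (reg_objective eps (mu \x nu)%E pi f <= reg_objective eps (mu \x nu)%E pi' f')%E.

Definition is_monge_map {R : realType} {n : nat} (mu nu : set (Rd R n) -> \bar R)
  (T : Rd R n -> Rd R n) :=
  measurable_fun setT T /\
  (forall E, measurable E -> nu E = mu (T @^-1` E)) /\
  forall S : Rd R n -> Rd R n, measurable_fun setT S ->
    (forall E, measurable E -> nu E = mu (S @^-1` E)) ->
    (\int[mu]_x (cost (x, T x))%:E <= \int[mu]_x (cost (x, S x))%:E)%E.

(* Main.v *)
(* Put x' = x S and y' = (y - a) A^-1 S. The map T becomes the identity, the cost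
   becomes |x' - y'|^2 / 2 up to functions of one variable, and the problem is a
   self-transport problem with a symmetric potential: the optimal density is
   (phi x + phi y - c)_+ / eps, where int (phi x + phi y - c)_+ dmu(y) = eps.
   Let L be the largest displacement on its support. Comparing this equation at
   two points at distance at most delta gives |phi x - phi x'| <= delta^2 / 2 +
   delta L, and averaging it over a ball of radius delta and mass
   m = eps / delta^2 gives phi x + phi x' <= 3 delta^2 / 2 for some x' in the ball.
   Hence L^2 / 2 <= phi x + phi y <= 2 delta^2 + delta L, so that L <= 8 delta.

   Instead of the potential itself, approximate ones are used: iterates of a damped
   fixed point map that contracts the sup norm. Weak duality shows that the optimal
   density has arbitrarily small L^2 mass where the approximate plan vanishes.

   The mass of the balls is bounded below through the linear change of variables
   for Lebesgue measure, which is proved from translation invariance and the LUP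
   decomposition. *)
Require Import Defs.
From HB Require Import structures.
From mathcomp Require Import all_boot all_order fingroup perm all_algebra.
From mathcomp Require Import all_classical all_reals all_analysis.
From mathcomp Require Import measurable_realfun ring lra.
Import Order.TTheory GRing.Theory Num.Theory numFieldNormedType.Exports.
Local Open Scope classical_set_scope.
Local Open Scope ring_scope.

Set Implicit Arguments.
Unset Strict Implicit.
Unset Printing Implicit Defensive.

(** * Approximate potentials *)

(** The undamped map [phi - rowint mu e phi + eps] is only nonexpansive in the sup norm, so damping
    is what makes the iteration converge; its price is an error [lam * phi] in the marginal
    equation. The iteration also needs a bounded cost, whence the truncation of the quadratic cost
    outside [Omega]. No regularity of the potential and no lower bound on the mass where a slack is
    positive are at hand. Values at nearby points are therefore compared by contradiction: a uniform
    additive gain of slack is turned into a multiplicative gain, which the marginal equation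
    forbids. With exact potentials and an attained maximum the argument gives L <= (1 + sqrt 5)
    delta. The constant 8 leaves room for the error [eta] in the marginals and for a supremum L that
    need not be attained. A ball of radius delta has mass at least P delta^d with P =
    [lamA * kappaA * omega d]. Taking m = P delta^d in m delta^2 = eps gives delta^(d+2) = eps / P,
    which is the source of the exponent. *)

Lemma bounded_integrable d (T : measurableType d) (R : realType)
    (mu : probability T R) (M : R) (f : T -> R) :
  measurable_fun setT f -> (forall x, `|f x| <= M) ->
  mu.-integrable setT (EFin \o f).
Proof.
move=> mf fM; apply: measurable_bounded_integrable => //.
  by rewrite [X in (X < _)%E]probability_setT ltry.
exists M; split; first exact: num_real.
by move=> t Mt x _; exact: le_trans (fM x) (ltW Mt).
Qed.

Lemma Rintegral_le_add d (T : measurableType d) (R : realType)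
    (mu : probability T R) (M c : R) (f g : T -> R) :
  measurable_fun setT f -> measurable_fun setT g ->
  (forall x, `|f x| <= M) -> (forall x, `|g x| <= M) ->
  (forall x, f x <= g x + c) ->
  \int[mu]_x f x <= \int[mu]_x g x + c.
Proof.
move=> mf mg fM gM fg.
have ic : mu.-integrable setT (EFin \o (fun=> c : R)).
  by apply: (@bounded_integrable _ _ _ _ `|c|).
have ig : mu.-integrable setT (EFin \o g) by exact: bounded_integrable gM.
have -> : c = \int[mu]_(x in setT) c.
  by rewrite Rintegral_cst// [X in fine X]probability_setT mulr1.
rewrite -RintegralD//; apply: le_Rintegral => //.
- exact: bounded_integrable fM.
- exact: (integrableD measurableT ig ic).
Qed.

Lemma Rintegral_cst_prob d (T : measurableType d) (R : realType)
    (mu : probability T R) (c : R) : \int[mu]_x c = c.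
Proof. by rewrite Rintegral_cst// [X in fine X]probability_setT mulr1. Qed.

Lemma measurable_Rintegral_param d d' (T : measurableType d) (U : measurableType d')
    (R : realType) (mu : probability U R) (f : T * U -> R) :
  measurable_fun setT f -> (forall z, 0 <= f z) ->
  measurable_fun setT (fun x => \int[mu]_y f (x, y)).
Proof.
move=> mf f0; rewrite /Rintegral.
have mF : measurable_fun setT (fubini_F mu (EFin \o f)).
  by apply: measurable_fun_fubini_tonelli_F => [|z]; [exact/measurable_EFinP | rewrite lee_fin].
have mfine : measurable_fun [set: \bar R] (@fine R) by exact: fine_measurable.
exact: (measurableT_comp mfine mF).
Qed.

(** This is [eps] times the candidate density. Two potentials on two spaces are allowed because the
    original problem has [psi = phi \o U], while the self-transport problem has [psi = phi]. *)
Definition slack {X Y : Type} {R : realType} (phi : X -> R) (psi : Y -> R)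
  (c : X * Y -> R) (z : X * Y) : R := Num.max (phi z.1 + psi z.2 - c z) 0.

Lemma slack_ge0 (X Y : Type) (R : realType) (phi : X -> R) (psi : Y -> R) c z :
  0 <= slack phi psi c z.
Proof. by rewrite /slack le_max lexx orbT. Qed.

Lemma slack_ge (X Y : Type) (R : realType) (phi : X -> R) (psi : Y -> R) c z :
  phi z.1 + psi z.2 - c z <= slack phi psi c z.
Proof. by rewrite /slack le_max lexx. Qed.

Lemma max0_le (R : realType) (a b : R) : a <= b -> 0 <= b -> Num.max a 0 <= b.
Proof. by move=> ab b0; rewrite ge_max ab b0. Qed.

Lemma slackP (X Y : Type) (R : realType) (phi : X -> R) (psi : Y -> R) c z :
  (slack phi psi c z = phi z.1 + psi z.2 - c z /\ 0 <= phi z.1 + psi z.2 - c z) \/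
  (slack phi psi c z = 0 /\ phi z.1 + psi z.2 - c z <= 0).
Proof.
rewrite /slack; case: (leP (phi z.1 + psi z.2 - c z) 0) => h.
  by right; split.
by left; split => //; exact: ltW.
Qed.

Lemma slack_le (X Y : Type) (R : realType) (phi : X -> R) (psi : Y -> R)
    (c : X * Y -> R) (N : R) z :
  0 <= N -> (forall x, `|phi x| <= N) -> (forall y, `|psi y| <= N) ->
  (forall z, 0 <= c z) -> slack phi psi c z <= 2 * N.
Proof.
move=> N0 hphi hpsi c0; apply: max0_le; last lra.
have := hphi z.1; have := hpsi z.2; rewrite !ler_norml => /andP[_ h1] /andP[_ h2].
have := c0 z; lra.
Qed.

Lemma measurable_slack d d' (X : measurableType d) (Y : measurableType d')
    (R : realType) (phi : X -> R) (psi : Y -> R) (c : X * Y -> R) :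
  measurable_fun setT phi -> measurable_fun setT psi -> measurable_fun setT c ->
  measurable_fun setT (slack phi psi c).
Proof.
move=> mphi mpsi mc; apply: measurable_maxr => //; apply: measurable_funB => //.
apply: measurable_funD; first exact: (measurableT_comp mphi measurable_fst).
exact: (measurableT_comp mpsi measurable_snd).
Qed.

Lemma geometric_small (R : realType) (q C eta : R) :
  0 <= q < 1 -> 0 < eta -> exists k, q ^+ k * C <= eta.
Proof.
move=> /andP[q0 q1] eta0.
have q1' : `|q| < 1 by rewrite ger0_norm.
have [C0|C0] := leP C 0.
  by exists 0%N; rewrite expr0 mul1r; apply: le_trans (ltW eta0).
have /cvgrPdist_lt/(_ _ (divr_gt0 eta0 C0)) [k _ /(_ k (leqnn k))] := cvg_expr q1'.
rewrite /= sub0r normrN ger0_norm ?exprn_ge0// ltr_pdivlMr// => h.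
by exists k; exact: ltW.
Qed.

(** * Damped fixed point iteration for the potential *)

Definition rowint {d} {X : measurableType d} {R : realType} (mu : probability X R)
  (e : X * X -> R) (phi : X -> R) (x : X) : R := \int[mu]_y slack phi phi e (x, y).

(** A fixed point satisfies [rowint mu e phi x = eps - lam * phi x], which is the marginal equation
    up to the damping term. *)
Definition potential_step {d} {X : measurableType d} {R : realType}
  (mu : probability X R) (e : X * X -> R) (eps lam : R) (phi : X -> R) (x : X) : R :=
  (phi x - rowint mu e phi x + eps) / (1 + lam).

(* The invariant set of the damped fixed point iteration; the bounds do not
   depend on the damping [lam], so that [lam] may tend to 0. *)
Definition admissible {d} {X : measurableType d} {R : realType} (K eps : R)
  (phi : X -> R) := [/\ measurable_fun setT phi,
  forall x x', phi x - phi x' <= K, forall x, phi x <= K + 2 * eps &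
  forall x, - (2 * K + 2 * eps) <= phi x].

Lemma admissible_norm d (X : measurableType d) (R : realType) (K eps : R)
    (phi : X -> R) x : 0 <= K -> admissible K eps phi -> `|phi x| <= 2 * K + 2 * eps.
Proof.
move=> K0 [_ _ /(_ x) h1 /(_ x) h2]; rewrite ler_norml; apply/andP; split => //; lra.
Qed.

Lemma slack_row_norm d (X : measurableType d) (R : realType) (e : X * X -> R)
    (K eps : R) (phi : X -> R) z :
  (forall z, 0 <= e z <= K) -> 0 < eps -> admissible K eps phi ->
  `|slack phi phi e z| <= 2 * (2 * K + 2 * eps).
Proof.
move=> e0K eps0 aphi.
have K0 : 0 <= K by have /andP[a b] := e0K z; exact: le_trans a b.
rewrite ger0_norm ?slack_ge0//; apply: slack_le; [lra| | |].
- by move=> x; exact: admissible_norm.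
- by move=> x; exact: admissible_norm.
- by move=> w; have /andP[] := e0K w.
Qed.

Lemma measurable_slack_row d (X : measurableType d) (R : realType) (e : X * X -> R)
    (phi : X -> R) x : measurable_fun setT e -> measurable_fun setT phi ->
  measurable_fun setT (fun y => slack phi phi e (x, y)).
Proof.
move=> me mphi; exact: (measurableT_comp (measurable_slack mphi mphi me) (measurable_pair1 x)).
Qed.

Lemma rowint_le_add d (X : measurableType d) (R : realType) (mu : probability X R)
    (e : X * X -> R) (K eps : R) (phi psi : X -> R) x x' (c : R) :
  measurable_fun setT e -> (forall z, 0 <= e z <= K) -> 0 < eps ->
  admissible K eps phi -> admissible K eps psi ->
  (forall y, slack phi phi e (x, y) <= slack psi psi e (x', y) + c) ->
  rowint mu e phi x <= rowint mu e psi x' + c.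
Proof.
move=> me eK eps0 aphi apsi h.
apply: (@Rintegral_le_add _ _ _ _ (2 * (2 * K + 2 * eps))) => //.
- by apply: measurable_slack_row => //; case: aphi.
- by apply: measurable_slack_row => //; case: apsi.
- by move=> y; apply: slack_row_norm.
- by move=> y; apply: slack_row_norm.
Qed.

(** Oscillation: a larger value of [phi] enlarges the row integral by the same amount up to the
    oscillation [K] of [e]. Upper bound: once [phi x] exceeds [K + eps], every slack in its row is
    at least [eps], so the step cannot increase it. Lower bound: the row integral is at most the
    positive part of [2 * phi x + K], so the step either does not decrease [phi x] or is controlled
    by the upper bound. *)
Lemma potential_step_admissible d (X : measurableType d) (R : realType)
    (mu : probability X R) (e : X * X -> R) (K eps lam : R) (phi : X -> R) :
  measurable_fun setT e -> (forall z, 0 <= e z <= K) -> 0 < eps -> 0 < lam ->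
  admissible K eps phi -> admissible K eps (potential_step mu e eps lam phi).
Proof.
move=> me eK eps0 lam0 aphi; have lam1 : 0 < 1 + lam by lra.
have [mphi oscphi ubphi lbphi] := aphi.
have le_div (a b : R) : 0 <= b -> a <= b -> a / (1 + lam) <= b.
  by move=> b0 ab; rewrite ler_pdivrMr//; apply: le_trans ab _; rewrite ler_peMr//; lra.
split.
- apply: measurable_funM => //; apply: measurable_funD => //; apply: measurable_funB => //.
  apply: measurable_Rintegral_param; first exact: measurable_slack.
  by move=> z; exact: slack_ge0.
- move=> x x'; rewrite /potential_step -mulrBl.
  have K0 : 0 <= K by have /andP[a b] := eK (x, x); exact: le_trans a b.
  apply: le_div => //.
  suff : rowint mu e phi x' <= rowint mu e phi x + (K - (phi x - phi x')) by lra.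
  apply: (@rowint_le_add _ _ _ _ _ K eps) => // y.
  have /andP[h1 h2] := eK (x', y); have /andP[h3 h4] := eK (x, y).
  have hd := oscphi x x'; have := slack_ge0 phi phi e (x, y).
  have := slack_ge phi phi e (x, y).
  by case: (slackP phi phi e (x', y)) => /= -[-> ?]; lra.
- move=> x; have K0 : 0 <= K by have /andP[a b] := eK (x, x); exact: le_trans a b.
  apply: le_div; first lra.
  have G0 : 0 <= rowint mu e phi x.
    by apply: Rintegral_ge0 => // y _; exact: slack_ge0.
  have [h|h] := leP (phi x) (K + eps); first lra.
  suff : eps <= rowint mu e phi x by have := ubphi x; lra.
  rewrite -(Rintegral_cst_prob mu eps) -[leRHS]addr0.
  apply: (@Rintegral_le_add _ _ _ _ (2 * (2 * K + 2 * eps))) => //.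
  + exact: measurable_slack_row.
  + by move=> y; rewrite gtr0_norm//; lra.
  + by move=> y; apply: slack_row_norm.
  + move=> y; have := slack_ge phi phi e (x, y) => /=.
    by have := oscphi x y; have /andP[_ h4] := eK (x, y); lra.
- move=> x; have K0 : 0 <= K by have /andP[a b] := eK (x, x); exact: le_trans a b.
  rewrite lerNl -mulNr; apply: le_div; first lra.
  have : rowint mu e phi x <= Num.max (2 * phi x + K) 0.
    rewrite -(Rintegral_cst_prob mu (Num.max _ _)) -[leRHS]addr0.
    apply: (@Rintegral_le_add _ _ _ _ (3 * (2 * K + 2 * eps))) => //.
    + exact: measurable_slack_row.
    + move=> y; apply: le_trans (slack_row_norm _ eK eps0 aphi) _ => //; lra.
    + move=> _; rewrite ger0_norm ?le_max ?lexx ?orbT//; apply: max0_le; last lra.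
      by have := ubphi x; lra.
    + move=> y; rewrite addr0; apply: max0_le; last by rewrite le_max lexx orbT.
      rewrite le_max; apply/orP; left => /=.
      by have := oscphi y x; have /andP[h4 _] := eK (x, y); lra.
  have := ubphi x; have := lbphi x.
  by case: (leP (2 * phi x + K) 0); lra.
Qed.

(** In [phi x - rowint mu e phi x] the change of [phi x] cancels against its own contribution to the
    slacks; what remains is the change of [phi y], averaged over a set of mass at most one. Hence
    the undamped map is nonexpansive, and the factor comes from the damping. *)
Lemma potential_step_contraction d (X : measurableType d) (R : realType)
    (mu : probability X R) (e : X * X -> R) (K eps lam D : R) (phi psi : X -> R) :
  measurable_fun setT e -> (forall z, 0 <= e z <= K) -> 0 < eps -> 0 < lam ->
  admissible K eps phi -> admissible K eps psi ->
  (forall x, `|phi x - psi x| <= D) ->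
  forall x, `|potential_step mu e eps lam phi x - potential_step mu e eps lam psi x|
            <= (1 + lam)^-1 * D.
Proof.
move=> me eK eps0 lam0; move: phi psi.
suff H (phi psi : X -> R) : admissible K eps phi -> admissible K eps psi ->
  (forall x, `|phi x - psi x| <= D) ->
  forall x, potential_step mu e eps lam phi x - potential_step mu e eps lam psi x
            <= (1 + lam)^-1 * D.
  move=> phi psi aphi apsi h x; rewrite ler_norml; apply/andP; split; last exact: H.
  by rewrite lerNl opprB; apply: H => // y; rewrite distrC.
move=> aphi apsi h x; rewrite /potential_step -mulrBl mulrC.
rewrite ler_pM2l ?invr_gt0; last lra.
suff : rowint mu e psi x <= rowint mu e phi x + (D - (phi x - psi x)) by lra.
apply: (@rowint_le_add _ _ _ _ _ K eps) => // y.
have := h x; have := h y; rewrite !ler_norml => /andP[? ?] /andP[? ?].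
have := slack_ge0 phi phi e (x, y); have := slack_ge phi phi e (x, y).
by case: (slackP psi psi e (x, y)) => /= -[-> ?]; lra.
Qed.

(** The defect of the iterate [u k] is [- (1 + lam) * (u k.+1 - u k) - lam * u k]. Since the bound
    [N] on the iterates does not depend on [lam], the damping is fixed first with
    [lam * N = eta / 2]; then [k] is taken so large that the increment is small too. *)
Lemma approximate_potential d (X : measurableType d) (R : realType)
    (mu : probability X R) (e : X * X -> R) (K eps eta : R) :
  measurable_fun setT e -> (forall z, 0 <= e z <= K) -> 0 <= K -> 0 < eps -> 0 < eta ->
  exists phi : X -> R, [/\ measurable_fun setT phi,
    forall x, `|phi x| <= 2 * K + 2 * eps &
    forall x, `|rowint mu e phi x - eps| <= eta].
Proof.
move=> me eK K0 eps0 eta0; set N := 2 * K + 2 * eps.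
have N0 : 0 < N by rewrite /N; lra.
have [lam lam0 lamN] : exists2 lam, 0 < lam & lam * N = eta / 2.
  by exists (eta / (2 * N)); [rewrite divr_gt0// mulr_gt0 | field; lra].
pose u := fix u k : X -> R := if k is j.+1 then potential_step mu e eps lam (u j) else fun=> 0.
have au k : admissible K eps (u k).
  elim: k => [|k IH] /=; last exact: potential_step_admissible.
  by split=> // *; lra.
pose q := (1 + lam)^-1.
have du k x : `|u k.+1 x - u k x| <= q ^+ k * (2 * N).
  elim: k x => [|k IH] x.
    rewrite expr0 mul1r; apply: le_trans (ler_normB _ _) _.
    by rewrite mulr_natl mulr2n; apply: lerD; exact: admissible_norm.
  rewrite exprS -mulrA.
  exact: (potential_step_contraction mu me eK eps0 lam0 (au k.+1) (au k) IH x).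
have q01 : 0 <= q < 1.
  by rewrite /q invr_ge0 invf_lt1; [apply/andP; split; lra|lra].
have eta2 : 0 < eta / 2 by lra.
have [k hk] := geometric_small (2 * N * (1 + lam)) q01 eta2.
exists (u k); split.
- by case: (au k).
- by move=> x; exact: admissible_norm.
- move=> x.
  have E : rowint mu e (u k) x - eps = - ((1 + lam) * (u k.+1 x - u k x)) - lam * u k x.
    have lam1 : 1 + lam != 0 by lra.
    by rewrite /= /potential_step; field.
  rewrite E; apply: le_trans (ler_normB _ _) _; rewrite normrN !normrM.
  rewrite (@gtr0_norm _ (1 + lam)) ?(@gtr0_norm _ lam)//; last lra.
  have h1 : (1 + lam) * `|u k.+1 x - u k x| <= eta / 2.
    apply: le_trans hk; rewrite [in leRHS]mulrA [leRHS]mulrC ler_wpM2l//; lra.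
  have h2 : lam * `|u k x| <= eta / 2.
    by rewrite -lamN; apply: ler_wpM2l; [exact: ltW | exact: admissible_norm].
  by rewrite [eta]splitr; exact: lerD.
Qed.

(** * Localization of the approximate plan near the diagonal *)

Lemma Rintegral_full d (T : measurableType d) (R : realType)
    (mu : probability T R) (D : set T) (M : R) (f : T -> R) :
  measurable D -> mu D = 1%E -> measurable_fun setT f -> (forall x, `|f x| <= M) ->
  \int[mu]_x f x = \int[mu]_(x in D) f x.
Proof.
move=> mD D1 mf fM; rewrite /Rintegral; congr fine.
have D0 : mu (~` D) = 0%E by rewrite probability_setC// D1 subee.
rewrite (negligible_integral _ _ _ D0)//; last exact: bounded_integrable fM.
  by rewrite setDE setCK setTI.
exact: measurableC.
Qed.

Lemma Rintegral_le_full d (T : measurableType d) (R : realType)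
    (mu : probability T R) (D : set T) (M : R) (f g : T -> R) :
  measurable D -> mu D = 1%E ->
  measurable_fun setT f -> measurable_fun setT g ->
  (forall x, `|f x| <= M) -> (forall x, `|g x| <= M) ->
  (forall x, D x -> f x <= g x) -> \int[mu]_x f x <= \int[mu]_x g x.
Proof.
move=> mD D1 mf mg fM gM fg.
rewrite (Rintegral_full mD D1 mf fM) (Rintegral_full mD D1 mg gM).
have hi (h : T -> R) : measurable_fun setT h -> (forall x, `|h x| <= M) -> mu.-integrable D (EFin \o h).
  move=> mh hM; apply: (integrableS measurableT) => //.
  exact: bounded_integrable hM.
by apply: le_Rintegral => //; exact: hi.
Qed.

(* With [e = dist^2 / 2], the conclusion says that the support of the
   approximate plan lies within distance [8 * dlt] of the diagonal. *)
Lemma slack_near_diagonal d (X : measurableType d) (R : realType)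
    (mu : probability X R) (e : X * X -> R) (Om : set X) (K N eps eta dlt m : R)
    (phi : X -> R) :
  measurable Om -> mu Om = 1%E ->
  measurable_fun setT e -> (forall z, 0 <= e z <= K) ->
  (forall x y, e (x, y) = e (y, x)) ->
  (forall x x' y (L : R), Om x -> Om x' -> Om y -> 0 <= L -> e (x, x') <= dlt ^+ 2 / 2 ->
     e (x', y) <= L ^+ 2 / 2 -> e (x, y) <= e (x', y) + dlt ^+ 2 / 2 + dlt * L) ->
  (forall x, Om x -> (m%:E <= mu (Om `&` [set y | (e (x, y) <= dlt ^+ 2 / 2)%R]))%E) ->
  0 < m -> 0 < dlt -> m * dlt ^+ 2 = eps ->
  0 < N -> 0 < eta -> eta <= eps / 8 ->
  eps + eta < (1 + dlt ^+ 2 / (8 * N)) * (eps - eta) ->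
  measurable_fun setT phi -> (forall x, `|phi x| <= N) ->
  (forall x, `|rowint mu e phi x - eps| <= eta) ->
  forall x y, Om x -> Om y -> 0 <= phi x + phi y - e (x, y) ->
  e (x, y) <= (8 * dlt) ^+ 2 / 2.
Proof.
move=> mOm Om1 me eK esym elip mball m0 dlt0 mdlt N0 eta0 etaeps etaN mphi phiN row.
move=> x0 y0 Ox0 Oy0 h0; rewrite leNgt; apply/negP => far.
have slackN z : `|slack phi phi e z| <= 2 * N.
  rewrite ger0_norm ?slack_ge0//; apply: slack_le => //; first exact: ltW.
  by move=> w; case/andP: (eK w).
(* The supremum [s = L ^ 2 / 2] of the cost over pairs with nonnegative [phi x + phi y - e] plays
   the part of the largest displacement. The assumed far pair gives [8 * dlt < L]. *)
pose E := [set r : R | exists x y, [/\ Om x, Om y, 0 <= phi x + phi y - e (x, y) &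
  r = e (x, y)]].
have hsE : has_sup E.
  split; first by exists (e (x0, y0)), x0, y0.
  by exists K => _ [x [y [_ _ _ ->]]]; case/andP: (eK (x, y)).
pose s := sup E.
have Es x y : Om x -> Om y -> 0 <= phi x + phi y - e (x, y) -> e (x, y) <= s.
  by move=> Ox Oy h; apply: ub_le_sup; [exact: hsE.2 | exists x, y].
have s_far : (8 * dlt) ^+ 2 / 2 < s by apply: lt_le_trans far (Es _ _ Ox0 Oy0 h0).
have s0 : 0 < s by apply: le_lt_trans s_far; rewrite divr_ge0// sqr_ge0.
pose L := Num.sqrt (2 * s).
have L2 : L ^+ 2 = 2 * s by rewrite sqr_sqrtr//; lra.
have L0 : 0 <= L by exact: sqrtr_ge0.
have L8 : 8 * dlt < L.
  by rewrite -(ltr_pXn2r (ltn0Sn 1)) ?nnegrE//; [lra | lra].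
(* Half the sum of two bounds for a suitable [x] near [x1]: [phi x1 + phi x] is at most
   [7 / 4 * dlt ^ 2], and [phi x1 - phi x] at most [3 / 4 * dlt ^ 2 + dlt * L]. *)
have half x1 : Om x1 -> phi x1 <= 5 / 4 * dlt ^+ 2 + dlt * L / 2.
  move=> Ox1.
  have [x [Ox xx1 hx]] : exists x, [/\ Om x, e (x1, x) <= dlt ^+ 2 / 2 &
      phi x1 + phi x - e (x1, x) <= (eps + 2 * eta) / m].
    (* Otherwise the slack exceeds [(eps + 2 * eta) / m] on a set of mass at least [m], and the row
       integral at [x1] is at least [eps + 2 * eta]. *)
    apply: contrapT => /forallNP no.
    pose S := Om `&` [set y | e (x1, y) <= dlt ^+ 2 / 2].
    have mS : measurable S.
      apply: measurableI => //.
      have me1 := measurableT_comp me (measurable_pair1 x1).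
      have := @measurable_fun_le _ _ _ setT _ (fun=> dlt ^+ 2 / 2) measurableT me1
        (@measurable_cst _ _ _ _ _ _).
      by rewrite setTI.
    have S_le : (eps + 2 * eta) / m * fine (mu S) <= rowint mu e phi x1.
      have -> : (eps + 2 * eta) / m * fine (mu S) =
          \int[mu]_y ((eps + 2 * eta) / m * \1_S y).
        rewrite RintegralZl//; last first.
          apply: (@bounded_integrable _ _ _ _ 1) => // y.
          by rewrite indicE; case: (y \in S); rewrite /= ?normr1 ?normr0.
        by rewrite /Rintegral integral_indic// setIT.
      have t0 : 0 <= (eps + 2 * eta) / m by rewrite divr_ge0//; lra.
      rewrite -[leRHS]addr0.
      apply: (@Rintegral_le_add _ _ _ _ ((eps + 2 * eta) / m + 2 * N)) => //.
      - by apply: measurable_funM => //; exact: measurable_indic.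
      - exact: measurable_slack_row.
      - move=> y; rewrite indicE; case: (y \in S); rewrite /= ?mulr1 ?mulr0 ?normr0.
          by rewrite ger0_norm//; lra.
        lra.
      - by move=> y; apply: le_trans (slackN _) _; lra.
      - move=> y; rewrite addr0 indicE; case: (boolP (y \in S)); last first.
          by rewrite mulr0 slack_ge0.
        rewrite inE => -[Oy hy]; rewrite /= mulr1.
        apply: le_trans (slack_ge _ _ _ _); rewrite leNgt; apply/negP => h.
        by apply: (no y); split => //; exact: ltW.
    have mS' : m <= fine (mu S).
      by rewrite -lee_fin fineK ?fin_num_measure//; exact: mball.
    have : (eps + 2 * eta) / m * m <= (eps + 2 * eta) / m * fine (mu S).
      by apply: ler_wpM2l => //; rewrite divr_ge0//; lra.
    rewrite divfK ?gt_eqF//.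
    by have := row x1; rewrite ler_norml => /andP[_ h]; lra.
  have hx2 : phi x1 <= phi x + dlt ^+ 2 / 2 + dlt * L + dlt ^+ 2 / 4.
    rewrite leNgt; apply/negP => big.
    (* If [phi x1] were larger, each positive slack in the row of [x] would be smaller by at least
       [dlt ^ 2 / 4] than the one in the row of [x1]. As slacks are at most [2 * N], this is a gain
       by the factor [tau], so the two row integrals could not both be within [eta] of [eps]. *)
    set tau := 1 + dlt ^+ 2 / (8 * N) in etaN.
    have tau0 : 1 < tau by rewrite /tau ltrDl divr_gt0// ?exprn_gt0//; lra.
    have : \int[mu]_y (tau * slack phi phi e (x, y)) <=
           \int[mu]_y slack phi phi e (x1, y).
      apply: (@Rintegral_le_full _ _ _ _ Om (tau * (2 * N))) => //.
      - by apply: measurable_funM => //; exact: measurable_slack_row.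
      - exact: measurable_slack_row.
      - by move=> y; rewrite normrM (@ger0_norm _ tau) ?ler_pM2l//; lra.
      - move=> y; apply: le_trans (slackN _) _; rewrite ler_peMl//; lra.
      - move=> y Oy; case: (slackP phi phi e (x, y)) => /= -[-> h]; last first.
          by rewrite mulr0 slack_ge0.
        apply: le_trans (slack_ge _ _ _ _) => /=.
        have e1 : e (x1, y) <= e (x, y) + dlt ^+ 2 / 2 + dlt * L.
          apply: elip => //; rewrite L2; have := Es _ _ Ox Oy h; lra.
        have e2 : dlt ^+ 2 / (8 * N) * (phi x + phi y - e (x, y)) <= dlt ^+ 2 / 4.
          have -> : dlt ^+ 2 / 4 = dlt ^+ 2 / (8 * N) * (2 * N) by field; exact: lt0r_neq0.
          apply: ler_wpM2l; first by rewrite divr_ge0// ?exprn_ge0//; lra.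
          have := slack_ge phi phi e (x, y); have /(le_trans (ler_norm _)) := slackN (x, y).
          by move=> /=; lra.
        rewrite /tau mulrDl mul1r; lra.
    rewrite RintegralZl//; last first.
      by apply: (@bounded_integrable _ _ _ _ (2 * N)) => //; exact: measurable_slack_row.
    rewrite -!/(rowint mu e phi _).
    have h1 : tau * (eps - eta) <= tau * rowint mu e phi x.
      apply: ler_wpM2l; first lra.
      by have := row x; rewrite ler_norml => /andP[h _]; lra.
    by have := row x1; rewrite ler_norml => /andP[_ h]; lra.
  have em : eps / m = dlt ^+ 2 by rewrite -mdlt mulrC mulKf// gt_eqF.
  have etam : eta / m <= dlt ^+ 2 / 8.
    by rewrite -em mulrAC ler_pM2r ?invr_gt0//.
  have : (eps + 2 * eta) / m = eps / m + 2 * (eta / m) by rewrite mulrDl mulrA.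
  lra.
(* A pair with cost above [3 / 4 * s = 3 / 8 * L ^ 2] suffices: [half] at both points bounds this
   cost by [5 / 2 * dlt ^ 2 + dlt * L], which is below [21 / 128 * L ^ 2] when [8 * dlt < L]. *)
have [_ [x1 [y1 [Ox1 Oy1 h1 ->]]] hs] := sup_adherent (divr_gt0 s0 (ltr0Sn R 3)) hsE.
rewrite -/s in hs.
have := half _ Ox1; have := half _ Oy1.
have dL : dlt * L <= L ^+ 2 / 8 by rewrite expr2; nra.
have dd : dlt ^+ 2 <= L ^+ 2 / 64 by rewrite !expr2; nra.
lra.
Qed.

(** * Densities and couplings *)

Import HBNNSimple.

Lemma integral_map d d' (X : measurableType d) (Y : measurableType d') (R : realType)
    (m1 : {measure set X -> \bar R}) (m2 : {measure set Y -> \bar R}) (h : X -> Y)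
    (f : Y -> \bar R) :
  measurable_fun setT h -> (forall A, measurable A -> m2 A = m1 (h @^-1` A)) ->
  measurable_fun setT f -> (forall y, (0 <= f y)%E) ->
  (\int[m2]_y f y = \int[m1]_x f (h x))%E.
Proof.
move=> mh H mf f0.
rewrite (@eq_measure_integral _ _ _ setT (pushforward m1 h)).
  by rewrite ge0_integral_pushforward//.
by move=> A mA _; exact: H.
Qed.

Lemma integral_density d (T : measurableType d) (R : realType)
    (mu nu : {measure set T -> \bar R}) (f : T -> R) (g : T -> \bar R) :
  measurable_fun setT f -> (forall x, 0 <= f x) ->
  (forall E, measurable E -> nu E = \int[mu]_(x in E) (f x)%:E)%E ->
  measurable_fun setT g -> (forall x, (0 <= g x)%E) ->
  (\int[nu]_x g x = \int[mu]_x (g x * (f x)%:E))%E.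
Proof.
move=> mf f0 nuE mg g0; pose h := nnsfun_approx measurableT mg.
have mfE : measurable_fun setT (fun x => (f x)%:E) by exact/measurable_EFinP.
have hcvg x : (h n x)%:E @[n --> \oo] --> g x by exact: cvg_nnsfun_approx.
have -> : (\int[nu]_x g x = limn (fun n => \int[nu]_x (h n x)%:E))%E.
  under eq_integral => x _ do rewrite -(cvg_lim _ (hcvg x))//.
  apply: monotone_convergence => //.
  - by move=> n; apply/measurable_EFinP.
  - by move=> n x _; rewrite lee_fin.
  - by move=> x _ a b ab; rewrite lee_fin; exact/lefP/nd_nnsfun_approx.
have -> : (\int[mu]_x (g x * (f x)%:E) = limn (fun n => \int[mu]_x ((h n x)%:E * (f x)%:E)))%E.
  have fg x : (g x * (f x)%:E = limn (fun n => (h n x)%:E * (f x)%:E))%E.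
    by apply/esym/cvg_lim => //; apply: cvgeZr.
  under eq_integral => x _ do rewrite fg.
  apply: monotone_convergence => //.
  - by move=> n; apply: emeasurable_funM => //; apply/measurable_EFinP.
  - by move=> n x _; rewrite mule_ge0 ?lee_fin.
  - move=> x _ a b ab; apply: lee_wpmul2r; first by rewrite lee_fin.
    by rewrite lee_fin; exact/lefP/nd_nnsfun_approx.
congr (limn _); apply/funext => n.
have mpre r : measurable (h n @^-1` [set r]) by exact: measurable_sfunP.
transitivity (\int[nu]_x (\sum_(y \in range (h n)) (y * \1_(h n @^-1` [set y]) x)%:E))%E.
  by apply: eq_integral => t _; rewrite /= fimfunE -fsumEFin.
rewrite ge0_integral_fsum//; last 2 first.
  - by move=> r; apply/measurable_EFinP; exact: measurable_funM.
  - by move=> r x _; exact: nnfun_muleindic_ge0.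
transitivity (\int[mu]_x (\sum_(y \in range (h n))
    (y * \1_(h n @^-1` [set y]) x)%:E * (f x)%:E))%E; last first.
  apply: eq_integral => x _.
  rewrite -ge0_mule_fsuml => [|y]; last exact: nnfun_muleindic_ge0.
  by rewrite fsumEFin // -(fimfunE _ x).
rewrite ge0_integral_fsum//; last 2 first.
  - by move=> y; apply: emeasurable_funM => //; apply/measurable_EFinP; exact: measurable_funM.
  - move=> m y _; apply: mule_ge0; last by rewrite lee_fin.
    exact: nnfun_muleindic_ge0.
apply: eq_fsbigr => r /[!inE] -[x0 _ hr].
have r0 : 0 <= r by rewrite -hr.
rewrite integralZl_indic_nnsfun// integral_indic// setIT nuE//.
under [RHS]eq_integral do rewrite EFinM -muleA.
rewrite ge0_integralZl//; last 2 first.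
  - by apply: emeasurable_funM => //; exact/measurable_EFinP.
  - by move=> x _; rewrite mule_ge0 ?lee_fin.
congr (_ * _)%E; rewrite integral_mkcond; apply: eq_integral => x _.
by rewrite epatch_indic muleC.
Qed.

(** The absolute value makes this a measure for every measurable [f], so that the instance carries
    no sign condition; it disappears for nonnegative densities. *)
Definition density_measure {d} {T : measurableType d} {R : realType}
  (mu : {measure set T -> \bar R}) (f : {mfun T >-> R}) : set T -> \bar R :=
  fun E => (\int[mu]_(x in E) (`|f x|)%:E)%E.

Lemma density_measure0 d (T : measurableType d) (R : realType)
  (mu : {measure set T -> \bar R}) (f : {mfun T >-> R}) : density_measure mu f set0 = 0%E.
Proof. exact: integral_set0. Qed.

Lemma density_measure_ge0 d (T : measurableType d) (R : realType)
  (mu : {measure set T -> \bar R}) (f : {mfun T >-> R}) A : (0 <= density_measure mu f A)%E.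
Proof. by apply: integral_ge0 => x _; rewrite lee_fin. Qed.

Lemma density_measure_sigma_additive d (T : measurableType d) (R : realType)
  (mu : {measure set T -> \bar R}) (f : {mfun T >-> R}) :
  semi_sigma_additive (density_measure mu f).
Proof.
move=> /= F mF tF mUF; rewrite /density_measure; apply: cvg_toP.
  apply: ereal_nondecreasing_is_cvgn => m n mn.
  apply: lee_sum_nneg_natr => // k _ _.
  by apply: integral_ge0 => /= x Fkx; rewrite lee_fin.
rewrite ge0_integral_bigcup//=.
apply: measurable_funTS; apply/measurable_EFinP.
exact: measurableT_comp.
Qed.

HB.instance Definition _ d (T : measurableType d) (R : realType)
  (mu : {measure set T -> \bar R}) (f : {mfun T >-> R}) :=
  isMeasure.Build d T R (density_measure mu f) (density_measure0 mu f)
    (density_measure_ge0 mu f) (@density_measure_sigma_additive d T R mu f).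

Lemma density_measure_exists d (T : measurableType d) (R : realType)
    (mu : {measure set T -> \bar R}) (f : T -> R) :
  measurable_fun setT f -> (forall x, 0 <= f x) ->
  exists nu : {measure set T -> \bar R},
    forall E, measurable E -> nu E = (\int[mu]_(x in E) (f x)%:E)%E.
Proof.
move=> mf f0; have F : isMeasurableFun _ _ _ _ f by constructor.
pose f' : {mfun T >-> R} := HB.pack f F.
exists (density_measure mu f') => E mE.
by apply: eq_integral => x _; rewrite ger0_norm// f0.
Qed.

(** * Coupling densities and weak duality *)

Definition coupling_density {d d'} {X : measurableType d} {Y : measurableType d'}
  {R : realType} (mu : probability X R) (nu : probability Y R) (f : X * Y -> R) :=
  [/\ measurable_fun setT f, forall z, 0 <= f z,
   forall A, measurable A -> (\int[mu \x nu]_(z in A `*` setT) (f z)%:E = mu A)%E &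
   forall B, measurable B -> (\int[mu \x nu]_(z in setT `*` B) (f z)%:E = nu B)%E].

Lemma coupling_density_rows d d' (X : measurableType d) (Y : measurableType d')
    (R : realType) (mu : probability X R) (nu : probability Y R) (g : X * Y -> R) :
  measurable_fun setT g -> (forall z, 0 <= g z) ->
  (forall x, \int[nu]_y (g (x, y))%:E = 1)%E ->
  (forall y, \int[mu]_x (g (x, y))%:E = 1)%E -> coupling_density mu nu g.
Proof.
move=> mg g0 row col; split => //.
- move=> A mA; rewrite integral_mkcond fubini_tonelli1; last 2 first.
  + apply/measurable_restrict => //; first exact: measurableX.
    by apply: measurable_funTS; exact/measurable_EFinP.
  + by move=> z; rewrite erestrict_ge0// => w _; rewrite lee_fin.
  transitivity (\int[mu]_x (\1_A x)%:E)%E; last by rewrite integral_indic// setIT.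
  apply: eq_integral => x _; rewrite /fubini_F indicE; case: (boolP (x \in A)) => xA /=.
    rewrite -[RHS](row x); apply: eq_integral => y _.
    by rewrite patchE ifT//; apply/mem_set; split => //=; exact/set_mem.
  rewrite integral0_eq// => y _; rewrite patchE ifF//.
  by apply/negbTE; apply: contra xA => /set_mem[/= ? _]; exact/mem_set.
- move=> B mB; rewrite integral_mkcond fubini_tonelli2; last 2 first.
  + apply/measurable_restrict => //; first exact: measurableX.
    by apply: measurable_funTS; exact/measurable_EFinP.
  + by move=> z; rewrite erestrict_ge0// => w _; rewrite lee_fin.
  transitivity (\int[nu]_x (\1_B x)%:E)%E; last by rewrite integral_indic// setIT.
  apply: eq_integral => y _; rewrite /fubini_G indicE; case: (boolP (y \in B)) => yB /=.
    rewrite -[RHS](col y); apply: eq_integral => x _.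
    by rewrite patchE ifT//; apply/mem_set; split => //=; exact/set_mem.
  rewrite integral0_eq// => x _; rewrite patchE ifF//.
  by apply/negbTE; apply: contra yB => /set_mem[/= _ ?]; exact/mem_set.
Qed.

Lemma coupling_density_integral_fst d d' (X : measurableType d) (Y : measurableType d')
    (R : realType) (mu : probability X R) (nu : probability Y R) (f : X * Y -> R)
    (u : X -> R) :
  coupling_density mu nu f -> measurable_fun setT u -> (forall x, 0 <= u x) ->
  (\int[mu \x nu]_z (u z.1 * f z)%:E = \int[mu]_x (u x)%:E)%E.
Proof.
move=> [mf f0 fA _] mu' u0.
have [rho rhoE] := density_measure_exists (mu \x nu)%E mf f0.
transitivity (\int[rho]_z (u z.1)%:E)%E.
  rewrite (@integral_density _ _ _ (mu \x nu)%E rho f) => [|//|//|//||]; last 2 first.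
  - by apply/measurable_EFinP; exact: (measurableT_comp mu' measurable_fst).
  - by move=> z; rewrite lee_fin.
  by apply: eq_integral => z _; rewrite EFinM.
apply/esym; apply: (@integral_map _ _ (X * Y)%type X R rho mu fst (EFin \o u)).
- exact: measurable_fst.
- move=> A mA; transitivity (rho (A `*` setT)).
    by rewrite rhoE; [exact/esym/fA | exact: measurableX].
  by congr (rho _); apply/seteqP; split => [[x y] [/=]|[x y]].
- exact/measurable_EFinP.
- by move=> x; rewrite lee_fin.
Qed.

Lemma coupling_density_integral_snd d d' (X : measurableType d) (Y : measurableType d')
    (R : realType) (mu : probability X R) (nu : probability Y R) (f : X * Y -> R)
    (u : Y -> R) :
  coupling_density mu nu f -> measurable_fun setT u -> (forall x, 0 <= u x) ->
  (\int[mu \x nu]_z (u z.2 * f z)%:E = \int[nu]_x (u x)%:E)%E.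
Proof.
move=> [mf f0 _ fB] mu' u0.
have [rho rhoE] := density_measure_exists (mu \x nu)%E mf f0.
transitivity (\int[rho]_z (u z.2)%:E)%E.
  rewrite (@integral_density _ _ _ (mu \x nu)%E rho f) => [|//|//|//||]; last 2 first.
  - by apply/measurable_EFinP; exact: (measurableT_comp mu' measurable_snd).
  - by move=> z; rewrite lee_fin.
  by apply: eq_integral => z _; rewrite EFinM.
apply/esym; apply: (@integral_map _ _ (X * Y)%type Y R rho nu snd (EFin \o u)).
- exact: measurable_snd.
- move=> A mA; transitivity (rho (setT `*` A)).
    by rewrite rhoE; [exact/esym/fB | exact: measurableX].
  by congr (rho _); apply/seteqP; split => [[x y] [/=]|[x y]].
- exact/measurable_EFinP.
- by move=> x; rewrite lee_fin.
Qed.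

Lemma integral_EFin_prob d (T : measurableType d) (R : realType)
    (mu : probability T R) (M : R) (f : T -> R) :
  measurable_fun setT f -> (forall x, `|f x| <= M) ->
  (\int[mu]_x (f x)%:E = (\int[mu]_x f x)%:E)%E.
Proof.
move=> mf fM; rewrite /Rintegral fineK//.
exact: integrable_fin_num (bounded_integrable mu mf fM).
Qed.

(* A function with nearly uniform marginals is corrected to a coupling density
   by shrinking it and adding a product of the marginal defects. *)
Lemma coupling_density_correction d d' (X : measurableType d) (Y : measurableType d')
    (R : realType) (mu : probability X R) (nu : probability Y R) (w : X * Y -> R)
    (W s : R) :
  measurable_fun setT w -> (forall z, 0 <= w z <= W) -> 0 < s <= 1 / 2 ->
  (forall x, `|\int[nu]_y w (x, y) - 1| <= s) ->
  (forall y, `|\int[mu]_x w (x, y) - 1| <= s) ->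
  exists2 g, coupling_density mu nu g & forall z, `|g z - w z| <= (2 * W + 9) * s.
Proof.
move=> mw wW /andP[s0 s12] row col.
have w0 z : 0 <= w z by case/andP: (wW z).
have wn z : `|w z| <= W by rewrite ger0_norm//; case/andP: (wW z).
pose m x := \int[nu]_y w (x, y); pose n y := \int[mu]_x w (x, y).
have mm : measurable_fun setT m by exact: measurable_Rintegral_param.
have mn : measurable_fun setT n.
  apply: (@measurable_Rintegral_param _ _ Y X R mu (fun z => w (z.2, z.1))) => //.
  by apply: (measurableT_comp mw); exact: measurable_fun_pair.
(* Marginals within [s] of 1, shrunk by [1 - 2 * s], leave defects between [s] and [3 * s]. The
   lower bound keeps the correction nonnegative and its total [Z] at least [s]; the correction
   [a * b / Z] is then at most [9 * s], the origin of the 9. *)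
pose a x := 1 - (1 - 2 * s) * m x; pose b y := 1 - (1 - 2 * s) * n y.
have bnd r : `|r - 1| <= s -> s <= 1 - (1 - 2 * s) * r <= 3 * s.
  rewrite ler_norml => /andP[h1 h2]; apply/andP; split; nra.
have ha x : s <= a x <= 3 * s by exact: bnd (row x).
have hb y : s <= b y <= 3 * s by exact: bnd (col y).
have an x : `|a x| <= 3 * s by rewrite ger0_norm; case/andP: (ha x) => h1 h2//; lra.
have bn x : `|b x| <= 3 * s by rewrite ger0_norm; case/andP: (hb x) => h1 h2//; lra.
have ma : measurable_fun setT a by apply: measurable_funB => //; exact: measurable_funM.
have mb : measurable_fun setT b by apply: measurable_funB => //; exact: measurable_funM.
pose Z := \int[mu]_x a x.
have mwr x : measurable_fun setT (fun y => w (x, y)).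
  exact: (measurableT_comp mw (measurable_pair1 x)).
have mwc y : measurable_fun setT (fun x => w (x, y)).
  exact: (measurableT_comp mw (measurable_pair2 y)).
have m0 x : 0 <= m x by apply: Rintegral_ge0.
have n0 x : 0 <= n x by apply: Rintegral_ge0.
have mW x : `|m x| <= 1 + s.
  by rewrite ger0_norm//; have := row x; rewrite -/(m x) ler_norml => /andP[_ h]; lra.
have nW x : `|n x| <= 1 + s.
  by rewrite ger0_norm//; have := col x; rewrite -/(n x) ler_norml => /andP[_ h]; lra.
have affine d1 (T : measurableType d1) (la : probability T R) (p : T -> R) :
    measurable_fun setT p -> (forall x, `|p x| <= 1 + s) ->
    \int[la]_x (1 - (1 - 2 * s) * p x) = 1 - (1 - 2 * s) * \int[la]_x p x.
  move=> mp pW; have ip := bounded_integrable la mp pW.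
  rewrite RintegralB//.
  - by rewrite Rintegral_cst_prob RintegralZl.
  - by apply: (@bounded_integrable _ _ _ _ 1) => // x; rewrite normr1.
  - apply: (@bounded_integrable _ _ _ _ (`|1 - 2 * s| * (1 + s))).
      exact: measurable_funM.
    by move=> x; rewrite normrM ler_wpM2l.
(* Both marginals of [w] have the same total by Tonelli, hence so do the defects. This makes [a] and
   [b] exactly the marginals of [a * b / Z]. *)
have ZE : Z = \int[nu]_y b y.
  rewrite /Z /a /b !affine//; congr (1 - _ * _); apply: EFin_inj.
  rewrite -!(@integral_EFin_prob _ _ _ _ (1 + s))//.
  transitivity (\int[mu]_x \int[nu]_y (w (x, y))%:E)%E.
    by apply: eq_integral => x _; rewrite (@integral_EFin_prob _ _ _ _ W).
  rewrite (fubini_tonelli (EFin \o w)).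
  - by apply: eq_integral => x _; rewrite /= (@integral_EFin_prob _ _ _ _ W).
  - exact/measurable_EFinP.
  - by move=> z; rewrite lee_fin.
have sZ : s <= Z.
  rewrite -(Rintegral_cst_prob mu s) -[leRHS]addr0.
  apply: (@Rintegral_le_add _ _ _ _ (3 * s)) => // x.
  - by rewrite ger0_norm; lra.
  - by rewrite addr0; case/andP: (ha x).
have Z0 : 0 < Z by lra.
pose g z := (1 - 2 * s) * w z + a z.1 * b z.2 / Z.
have g0 z : 0 <= g z.
  rewrite addr_ge0 ?mulr_ge0//; first lra; last by rewrite invr_ge0 ltW.
  - by case/andP: (ha z.1) => h1 _; lra.
  - by case/andP: (hb z.2) => h1 _; lra.
have mg : measurable_fun setT g.
  apply: measurable_funD; first exact: measurable_funM.
  apply: measurable_funM => //; apply: measurable_funM.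
  - exact: (measurableT_comp ma measurable_fst).
  - exact: (measurableT_comp mb measurable_snd).
have rowg d1 (T : measurableType d1) (la : probability T R) (p q : T -> R) c :
    measurable_fun setT p -> (forall x, `|p x| <= W) ->
    measurable_fun setT q -> (forall x, `|q x| <= 3 * s) ->
    \int[la]_x q x = Z -> c = 1 - (1 - 2 * s) * \int[la]_x p x ->
    (\int[la]_x ((1 - 2 * s) * p x + c * q x / Z)%:E = 1)%E.
  move=> mp pW mq qW qZ cE.
  have i1 : la.-integrable setT (EFin \o (fun x => (1 - 2 * s) * p x)).
    apply: (@bounded_integrable _ _ _ _ (`|1 - 2 * s| * W)).
      exact: measurable_funM.
    by move=> x; rewrite normrM ler_wpM2l.
  have i2 : la.-integrable setT (EFin \o (fun x => c / Z * q x)).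
    apply: (@bounded_integrable _ _ _ _ (`|c / Z| * (3 * s))).
      exact: measurable_funM.
    by move=> x; rewrite normrM ler_wpM2l.
  under eq_integral do rewrite mulrAC EFinD.
  rewrite integralD//= -[X in (X + _)%E]fineK ?integrable_fin_num//.
  rewrite -[X in (_ + X)%E]fineK ?integrable_fin_num// -EFinD.
  rewrite -!/(Rintegral _ _ _) !RintegralZl//; last 2 first.
  - exact: bounded_integrable qW.
  - exact: bounded_integrable pW.
  by rewrite qZ cE; congr EFin; field; lra.
exists g.
  apply: coupling_density_rows => // [x|y].
    by apply: (rowg _ _ nu (fun y => w (x, y)) b (a x)).
  under eq_integral do rewrite /g /= (mulrC (a _)).
  by apply: (rowg _ _ mu (fun x => w (x, y)) a (b y)).
move=> z; have -> : g z - w z = - (2 * s * w z) + a z.1 * b z.2 / Z by rewrite /g; ring.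
have h1 : 0 <= a z.1 * b z.2 / Z <= 9 * s.
  case/andP: (ha z.1) => ? ?; case/andP: (hb z.2) => ? ?; apply/andP; split.
    by rewrite divr_ge0 ?mulr_ge0//; lra.
  rewrite ler_pdivrMr//; apply: (@le_trans _ _ ((3 * s) * (3 * s))).
    by apply: ler_pM => //; lra.
  nra.
have h2 : 0 <= 2 * s * w z <= 2 * s * W.
  case/andP: (wW z) => ? ?; apply/andP; split; nra.
by rewrite ler_norml; apply/andP; split; lra.
Qed.

Definition quadratic_cost {d d'} {X : measurableType d} {Y : measurableType d'}
  {R : realType} (mu : probability X R) (nu : probability Y R) (c : X * Y -> R) (eps : R)
  (f : X * Y -> R) : \bar R :=
  (\int[mu \x nu]_z (c z * f z + eps / 2 * f z ^+ 2)%:E)%E.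

(* Weak duality: completing the square, [f] costs at least the value of the
   approximate dual potentials plus the mass of [f ^ 2] on [D], where the
   approximate plan [slack / eps] vanishes; the corrected approximate plan
   costs at most that value plus an error. *)
Lemma optimal_density_bound d d' (X : measurableType d) (Y : measurableType d')
    (R : realType) (mu : probability X R) (nu : probability Y R) (c f : X * Y -> R)
    (phi : X -> R) (psi : Y -> R) (K N eps s C : R) (D : set (X * Y)) :
  measurable_fun setT c -> (forall z, 0 <= c z <= K) -> 0 <= K -> 0 < eps -> 0 <= N ->
  coupling_density mu nu f ->
  (forall g, coupling_density mu nu g ->
     (quadratic_cost mu nu c eps f <= quadratic_cost mu nu c eps g)%E) ->
  measurable_fun setT phi -> (forall x, `|phi x| <= N) ->
  measurable_fun setT psi -> (forall y, `|psi y| <= N) ->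
  0 < s <= 1 / 2 ->
  (forall x, `|\int[nu]_y slack phi psi c (x, y) - eps| <= s * eps) ->
  (forall y, `|\int[mu]_x slack phi psi c (x, y) - eps| <= s * eps) ->
  measurable D -> (forall z, D z -> slack phi psi c z = 0) ->
  C = 2 * (2 * N / eps) + 9 ->
  (\int[mu \x nu]_z (eps / 2 * f z ^+ 2 * \1_D z)%:E <=
    (eps / 2 * (C * s) ^+ 2 + (2 * N + K) * (C * s))%:E)%E.
Proof.
move=> mc cK K0 eps0 N0 cf fopt mphi phiN mpsi psiN s01 row col mD D0 CE.
set err := _ + (2 * N + K) * (C * s).
have c0 z : 0 <= c z by case/andP: (cK z).
have mh : measurable_fun setT (slack phi psi c) by exact: measurable_slack.
have h0 := slack_ge0 phi psi c.
have hN z := slack_le z N0 phiN psiN c0.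
pose w z := slack phi psi c z / eps.
have mw : measurable_fun setT w by exact: measurable_funM.
have hw z : slack phi psi c z = eps * w z by rewrite /w mulrC divfK// gt_eqF.
have w0 z : 0 <= w z by rewrite divr_ge0// ltW.
have wW z : 0 <= w z <= 2 * N / eps by apply/andP; split; [exact: w0|rewrite /w ler_pM2r ?invr_gt0//; exact: hN].
have scale d1 (T : measurableType d1) (la : probability T R) (p : T -> R) :
    measurable_fun setT p -> (forall x, `|p x| <= 2 * N) ->
    `|\int[la]_x p x - eps| <= s * eps -> `|\int[la]_x (p x / eps) - 1| <= s.
  move=> mp pN; have ip := bounded_integrable la mp pN.
  have -> : \int[la]_x (p x / eps) = \int[la]_x (eps^-1 * p x).
    by congr (Rintegral _ _ _); apply/funext => x; rewrite mulrC.
  rewrite RintegralZl// => h.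
  have -> : eps^-1 * \int[la]_x p x - 1 = eps^-1 * (\int[la]_x p x - eps).
    by rewrite mulrBr mulVf// gt_eqF.
  by rewrite normrM gtr0_norm ?invr_gt0// mulrC ler_pdivrMr.
have hNn z : `|slack phi psi c z| <= 2 * N by rewrite ger0_norm.
have [||g cg gw] := coupling_density_correction mw wW s01 (mu := mu) (nu := nu).
- by move=> x; apply: scale => //; exact: (measurableT_comp mh (measurable_pair1 x)).
- by move=> y; apply: scale => //; exact: (measurableT_comp mh (measurable_pair2 y)).
have [mf f0 _ _] := cf; have [mg g0 _ _] := cg.
have cst_int p (r : R) : coupling_density mu nu p -> 0 <= r ->
    (\int[mu \x nu]_z (r * p z)%:E = r%:E)%E.
  move=> cp r0; rewrite (coupling_density_integral_fst (u := fun=> r) cp)//.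
  by rewrite integral_cst// [X in (_ * X)%E]probability_setT mule1.
(* The potentials are shifted by [N] so that all integrands are nonnegative and integrals can be
   split without integrability conditions. The shift costs [2 * N] against any coupling, which is
   compensated in [Q]. *)
pose I := (\int[mu]_x (phi x + N)%:E + \int[nu]_y (psi y + N)%:E)%E.
have phi0 x : 0 <= phi x + N by have := phiN x; rewrite ler_norml => /andP[? _]; lra.
have psi0 y : 0 <= psi y + N by have := psiN y; rewrite ler_norml => /andP[? _]; lra.
have mphiN : measurable_fun setT (fun x => phi x + N) by exact: measurable_funD.
have mpsiN : measurable_fun setT (fun y => psi y + N) by exact: measurable_funD.
have mphi1 : measurable_fun setT (fun z : X * Y => phi z.1 + N).
  exact: (measurableT_comp mphiN measurable_fst).
have mpsi1 : measurable_fun setT (fun z : X * Y => psi z.2 + N).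
  exact: (measurableT_comp mpsiN measurable_snd).
have Ifin : I \is a fin_num.
  rewrite fin_numD; apply/andP; split; apply: integrable_fin_num => //;
    apply: (@bounded_integrable _ _ _ _ (2 * N)) => // x.
  - by rewrite ger0_norm//; have := phiN x; rewrite ler_norml => /andP[_ ?]; lra.
  - by rewrite ger0_norm//; have := psiN x; rewrite ler_norml => /andP[_ ?]; lra.
have dual p : coupling_density mu nu p ->
    (\int[mu \x nu]_z ((phi z.1 + N) * p z + (psi z.2 + N) * p z)%:E = I)%E.
  move=> cp; have [mp p0 _ _] := cp.
  under eq_integral do rewrite EFinD.
  rewrite ge0_integralD//.
  - by rewrite (coupling_density_integral_fst (u := fun x => phi x + N) cp)//
      (coupling_density_integral_snd (u := fun x => psi x + N) cp).
  - by move=> z _; rewrite lee_fin mulr_ge0.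
  - by apply/measurable_EFinP; exact: measurable_funM.
  - by move=> z _; rewrite lee_fin mulr_ge0.
  - by apply/measurable_EFinP; exact: measurable_funM.
have msq (p : X * Y -> R) : measurable_fun setT p ->
    measurable_fun setT (fun z => eps / 2 * p z ^+ 2).
  by move=> mp; apply: measurable_funM => //; exact: measurable_funX.
have sq0 (r : R) : 0 <= eps / 2 * r ^+ 2 by rewrite mulr_ge0 ?sqr_ge0//; lra.
pose Q := (\int[mu \x nu]_z (eps / 2 * w z ^+ 2)%:E + (2 * N)%:E)%E.
have primal p : coupling_density mu nu p ->
    (\int[mu \x nu]_z (c z * p z + eps / 2 * p z ^+ 2
       + (eps / 2 * w z ^+ 2 + 2 * N * p z))%:E = quadratic_cost mu nu c eps p + Q)%E.
  move=> cp; have [mp p0 _ _] := cp.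
  under eq_integral do rewrite EFinD.
  have mNp : measurable_fun setT (fun z => 2 * N * p z) by exact: measurable_funM.
  rewrite ge0_integralD//.
  - congr (_ + _)%E; under eq_integral do rewrite EFinD.
    rewrite ge0_integralD//.
    + by rewrite (cst_int _ (2 * N) cp) ?mulr_ge0.
    + by move=> z _; rewrite lee_fin.
    + by apply/measurable_EFinP; exact: msq.
    + by move=> z _; rewrite lee_fin mulr_ge0// mulr_ge0.
    + exact/measurable_EFinP.
  - by move=> z _; rewrite lee_fin addr_ge0// mulr_ge0.
  - by apply/measurable_EFinP; apply: measurable_funD; [exact: measurable_funM|exact: msq].
  - by move=> z _; rewrite lee_fin addr_ge0// !mulr_ge0.
  - by apply/measurable_EFinP; apply: measurable_funD; [exact: msq|].
(* Pointwise, [(phi + psi - c) * f <= eps * w * f], and off [D] this is at most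
   [eps / 2 * (f ^ 2 + w ^ 2)]. On [D], where [w = 0], the left side is nonpositive, so the whole
   term [eps / 2 * f ^ 2] is gained. *)
have lower : (\int[mu \x nu]_z (eps / 2 * f z ^+ 2 * \1_D z)%:E + I <=
    quadratic_cost mu nu c eps f + Q)%E.
  rewrite -primal// -(dual _ cf) -ge0_integralD//; last 4 first.
  - by move=> z _; rewrite lee_fin mulr_ge0.
  - apply/measurable_EFinP; apply: measurable_funM; [exact: msq|exact: measurable_indic].
  - by move=> z _; rewrite lee_fin addr_ge0// mulr_ge0.
  - by apply/measurable_EFinP; apply: measurable_funD; exact: measurable_funM.
  apply: ge0_le_integral => //.
  - by move=> z _; rewrite -EFinD lee_fin; do ?[exact: phi0|exact: psi0|exact: sq0|apply: addr_ge0|apply: mulr_ge0].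
  - apply/measurable_EFinP; apply: measurable_funD.
      by apply: measurable_funM; [exact: msq|exact: measurable_indic].
    by apply: measurable_funD; exact: measurable_funM.
  - apply/measurable_EFinP; apply: measurable_funD; apply: measurable_funD => //;
      by [exact: msq|exact: measurable_funM].
  - move=> z _; rewrite -EFinD lee_fin indicE.
    have fz := f0 z; have wz := w0 z.
    have := slack_ge phi psi c z; rewrite hw => hle.
    case: (boolP (z \in D)) => [/set_mem/D0|_] /=.
      rewrite hw => /eqP; rewrite mulf_eq0 (gt_eqF eps0)/= => /eqP w00.
      rewrite w00 in hle *; rewrite mulr1; nra.
    have : 0 <= eps / 2 * (f z - w z) ^+ 2 by [].
    have : (phi z.1 + psi z.2 - c z) * f z <= eps * w z * f z by exact: ler_wpM2r.
    rewrite mulr0; lra.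
(* The duality gap of [g] is the integral of [eps / 2 * (g - w) ^ 2 + (eps * w - (phi + psi - c)) *
   g]. The second term vanishes where the slack is positive; elsewhere [w = 0], so [g] itself is at
   most [C * s]. *)
have upper : (quadratic_cost mu nu c eps g + Q <= I + err%:E)%E.
  have P1 : (mu \x nu)%E setT = 1%E.
    rewrite -setXTT product_measure1E//.
    by rewrite [X in (X * _)%E]probability_setT [X in (_ * X)%E]probability_setT mule1.
  have Cs0 : 0 <= C * s.
    rewrite CE mulr_ge0//; last by case/andP: s01 => /ltW.
    by rewrite addr_ge0// mulr_ge0// divr_ge0 ?mulr_ge0// ltW.
  have err0 : 0 <= err by rewrite addr_ge0// mulr_ge0//; lra.
  have -> : err%:E = (\int[mu \x nu]_z err%:E)%E by rewrite integral_cst// [X in (_ * X)%E]P1 mule1.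
  rewrite -primal// -(dual _ cg) -ge0_integralD//; last 2 first.
  - by move=> z _; rewrite lee_fin addr_ge0// mulr_ge0.
  - by apply/measurable_EFinP; apply: measurable_funD; exact: measurable_funM.
  apply: ge0_le_integral => //.
  - by move=> z _; rewrite lee_fin; do ?[exact: phi0|exact: psi0|exact: sq0|apply: addr_ge0|apply: mulr_ge0].
  - apply/measurable_EFinP; apply: measurable_funD; apply: measurable_funD => //;
      by [exact: msq|exact: measurable_funM].
  - apply/measurable_EFinP; apply: measurable_funD => //.
    by apply: measurable_funD; exact: measurable_funM.
  - move=> z _; rewrite -EFinD lee_fin.
    have gz := g0 z; have := gw z; rewrite -CE => gC.
    have h1 : eps / 2 * (g z - w z) ^+ 2 <= eps / 2 * (C * s) ^+ 2.
      rewrite ler_pM2l ?divr_gt0// -real_normK ?num_real//.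
      by rewrite lerXn2r ?nnegrE//; exact: le_trans gC.
    have h2 : (eps * w z - (phi z.1 + psi z.2 - c z)) * g z <= (2 * N + K) * (C * s).
      case: (slackP phi psi c z) => -[E hz].
        by rewrite -hw E subrr mul0r mulr_ge0//; lra.
      have w00 : w z = 0 by rewrite /w E mul0r.
      rewrite w00 subr0 ger0_norm// in gC; rewrite w00 mulr0 sub0r.
      apply: ler_pM => //; first lra.
      have := phiN z.1; have := psiN z.2; rewrite !ler_norml => /andP[? _] /andP[? _].
      by case/andP: (cK z) => _ ?; lra.
    rewrite /err; lra.
have : (\int[mu \x nu]_z (eps / 2 * f z ^+ 2 * \1_D z)%:E + I <= I + err%:E)%E.
  apply: le_trans lower _; apply: le_trans upper.
  by apply: leeD2r; exact: fopt.
by rewrite addeC leeD2lE.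
Qed.

(** * Linear change of variables for Lebesgue measure *)

Lemma open_rowP (R : realType) (n : nat) (U : set 'rV[R]_n.+1) x :
  open U -> U x -> exists2 e : R, 0 < e & forall y : 'rV[R]_n.+1, (forall j, `|x 0 j - y 0 j| < e) -> U y.
Proof.
move=> oU Ux; have : nbhs x U by apply: open_nbhs_nbhs.
move=> /nbhs_ballP [e /= e0 xeU]; exists e => // y xy; apply: xeU; split => // i j.
by rewrite !ord1; exact: xy.
Qed.

(** Half-open boxes are stable under intersection, and a coordinate hyperplane cuts one into two
    disjoint ones. The first property serves the uniqueness of measures, the second additivity in
    each side length. *)
Definition hbox {R : realType} {n : nat} (a b : 'rV[R]_n.+1) : set (Rd R n) :=
  [set x : Rd R n | forall i, a 0 i <= x 0 i < b 0 i].

Lemma measurable_open (R : realType) (n : nat) (U : set 'rV[R]_n.+1) :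
  open U -> measurable (U : set (Rd R n)).
Proof. by move=> oU; exact: sub_sigma_algebra. Qed.

Lemma measurable_coord (R : realType) (n : nat) (i : 'I_n.+1) :
  measurable_fun setT (fun x : Rd R n => x 0 i).
Proof.
apply: (measurability _ (RGenOpens.measurableE R)) => _ [_ [a [b ->]] <-].
rewrite setTI; apply: measurable_open.
apply: (@open_comp _ _ (fun x : 'rV[R]_n.+1 => x 0 i)); last exact: interval_open.
by move=> x _; exact: coord_continuous.
Qed.

Lemma measurable_hbox (R : realType) (n : nat) (a b : 'rV[R]_n.+1) :
  measurable (hbox a b).
Proof.
have -> : hbox a b = \bigcap_(i in [set: 'I_n.+1])
    ((fun x : Rd R n => x 0 i) @^-1` [set` `[a 0 i, b 0 i[%R]).
  apply/seteqP; split => x.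
    by move=> h i _ /=; rewrite in_itv /=; exact: h.
  by move=> h i; have := h i I; rewrite /= in_itv.
apply: fin_bigcap_measurable => // i _; rewrite -[X in measurable X]setTI.
exact: measurable_coord.
Qed.

Lemma setI_closed_hbox (R : realType) (n : nat) :
  setI_closed [set A : set (Rd R n) | exists a b, A = hbox a b].
Proof.
move=> _ _ [a [b ->]] [c [d ->]].
exists (\row_i Num.max (a 0 i) (c 0 i)), (\row_i Num.min (b 0 i) (d 0 i)).
apply/seteqP; split => x.
  move=> [h1 h2] i; rewrite !mxE ge_max lt_min.
  by have /andP[-> ->] := h1 i; have /andP[-> ->] := h2 i.
by move=> h; split => i; have := h i; rewrite !mxE ge_max lt_min => /andP[/andP[? ?] /andP[? ?]]; apply/andP.
Qed.

(** The condition that the box lies in [U] is folded into the set, which is empty when it fails. The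
    union then runs over the whole countable type of pairs of rational corners. *)
Lemma open_bigcup_hbox (R : realType) (n : nat) (U : set 'rV[R]_n.+1) : open U ->
  U = \bigcup_(pq : 'rV[rat]_n.+1 * 'rV[rat]_n.+1)
        [set x | hbox (map_mx ratr pq.1) (map_mx ratr pq.2) x /\
           hbox (map_mx ratr pq.1) (map_mx ratr pq.2) `<=` (U : set (Rd R n))].
Proof.
move=> oU; apply/seteqP; split => [x Ux|x [pq _ [h1 h2]]]; last exact: h2.
have [e e0 eU] := open_rowP oU Ux.
have lo (i : 'I_n.+1) : exists q : rat, x 0 i - e < ratr q < x 0 i.
  by have [|q] := @rat_in_itvoo R (x 0 i - e) (x 0 i); [lra | rewrite in_itv /=; exists q].
have hi (i : 'I_n.+1) : exists q : rat, x 0 i < ratr q < x 0 i + e.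
  by have [|q] := @rat_in_itvoo R (x 0 i) (x 0 i + e); [lra | rewrite in_itv /=; exists q].
have [p hp] := choice lo; have [q hq] := choice hi.
exists (\row_i p i, \row_i q i) => //=; split.
  by move=> i; rewrite !mxE; have := hp i; have := hq i; lra.
move=> y hy; apply: eU => j; have := hy j; rewrite !mxE.
by have := hp j; have := hq j; rewrite ltr_norml; lra.
Qed.

Lemma sigma_hbox (R : realType) (n : nat) :
  @measurable _ (Rd R n) = <<s [set A : set (Rd R n) | exists a b, A = hbox a b] >>.
Proof.
apply/seteqP; split; last first.
  by apply: smallest_sub; [exact: sigma_algebra_measurable | move=> _ [a [b ->]]; exact: measurable_hbox].
apply: smallest_sub; first exact: smallest_sigma_algebra.
move=> U oU; rewrite (open_bigcup_hbox oU).
set G := [set A : set (Rd R n) | _].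
apply: (@countable_bigcupT_measurable _ (g_sigma_algebraType G)).
  exact: countableP.
move=> pq; have [h|h] := pselect (hbox (map_mx ratr pq.1) (map_mx ratr pq.2) `<=` (U : set (Rd R n))).
  apply: sub_sigma_algebra; exists (map_mx ratr pq.1), (map_mx ratr pq.2).
  by apply/seteqP; split => x; [case | split].
set p := map_mx _ _ in h *; set q := map_mx _ _ in h *.
have -> : [set x | hbox p q x /\ hbox p q `<=` (U : set (Rd R n))] = set0.
  by rewrite -subset0 => x [_ /h].
 exact: (@measurable0 _ (g_sigma_algebraType G)).
Qed.

Lemma measurable_fun_row d (T : measurableType d) (R : realType) (n : nat)
    (f : T -> Rd R n) :
  (forall i, measurable_fun setT (fun t => f t 0 i)) -> measurable_fun setT f.
Proof.
move=> mf; apply: (measurability _ (@sigma_hbox R n)) => _ [_ [a [b ->]] <-].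
rewrite setTI.
have -> : f @^-1` hbox a b = \bigcap_(i in [set: 'I_n.+1])
    ((fun t => f t 0 i) @^-1` [set` `[a 0 i, b 0 i[%R]).
  apply/seteqP; split => x.
    by move=> h i _ /=; rewrite in_itv /=; exact: h.
  by move=> h i; have := h i I; rewrite /= in_itv.
apply: fin_bigcap_measurable => // i _; rewrite -[X in measurable X]setTI.
exact: mf.
Qed.

Lemma measurable_mulmx (R : realType) (n : nat) (M : 'M[R]_n.+1) :
  measurable_fun setT (fun x : Rd R n => x *m M : Rd R n).
Proof.
apply: measurable_fun_row => i.
have -> : (fun x : Rd R n => (x *m M) 0 i) = (fun x => \sum_k x 0 k * M k i).
  by apply/funext => x; rewrite mxE.
apply: measurable_sum => k; apply: measurable_funM => //; exact: measurable_coord.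
Qed.

Lemma measurable_translation (R : realType) (n : nat) (v : 'rV[R]_n.+1) :
  measurable_fun setT (fun x : Rd R n => x + v : Rd R n).
Proof.
apply: measurable_fun_row => i.
have -> : (fun x : Rd R n => (x + v) 0 i) = (fun x => x 0 i + v 0 i).
  by apply/funext => x; rewrite mxE.
by apply: measurable_funD => //; exact: measurable_coord.
Qed.

Lemma hbox_measure_unique (R : realType) (n : nat)
    (m1 m2 : {measure set (Rd R n) -> \bar R}) :
  (forall a b, m1 (hbox a b) = m2 (hbox a b)) ->
  (forall a b, (m1 (hbox a b) < +oo)%E) ->
  forall A, measurable A -> m1 A = m2 A.
Proof.
move=> m12 m1fin.
apply: (@measure_unique _ R (Rd R n) [set A : set (Rd R n) | exists a b, A = hbox a b]
  (fun k => hbox (const_mx (- k%:R)) (const_mx k%:R))) => //.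
- exact: sigma_hbox.
- exact: setI_closed_hbox.
- by move=> i; exists (const_mx (- i%:R)), (const_mx i%:R).
- apply/seteqP; split => // x _.
  have [k hk] : exists k : nat, forall i, `|x 0 i| < k%:R.
    exists (\max_(i < n.+1) Num.bound (x 0%R i))%N => i.
    apply: lt_le_trans (archi_boundP _) _ => //.
    rewrite (_ : Num.bound `|x 0 i| = Num.bound (x 0 i)); last first.
      by rewrite /Num.bound normr_id.
    by rewrite ler_nat; exact: (leq_bigmax_cond (F := fun i => Num.bound (x 0 i))).
  exists k => // i; rewrite !mxE; have := hk i; rewrite ltr_norml => /andP[? ?].
  by apply/andP; split => //; exact: ltW.
- by move=> _ [a [b ->]].
Qed.

(** Changes one factor at a time. The error is linear in [t], the form in which box volumes are
    passed to the limit by [le_limit0]. *)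
Lemma prod_dist_le (R : realType) (I : Type) (r : seq I) (x y : I -> R) (B t : R) :
  1 <= B -> (forall i, 0 <= x i <= B) -> (forall i, 0 <= y i <= B) ->
  (forall i, `|x i - y i| <= t) ->
  `|\prod_(i <- r) x i - \prod_(i <- r) y i| <= (size r)%:R * B ^+ size r * t.
Proof.
move=> B1 hx hy hxy; elim: r => [|i r IH].
  by rewrite !big_nil subrr normr0 !mul0r.
have t0 : 0 <= t by apply: le_trans (hxy i).
have B0 : 0 <= B by lra.
have pB : `|\prod_(i <- r) x i| <= B ^+ size r.
  elim: r {IH} => [|j r IHr]; first by rewrite big_nil normr1 expr0.
  rewrite big_cons normrM exprS; apply: ler_pM => //.
  by case/andP: (hx j) => ? ?; rewrite ger0_norm.
rewrite !big_cons /= exprS.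
set p := \prod_(i <- r) x i in IH pB *; set q := \prod_(i <- r) y i in IH *.
have -> : x i * p - y i * q = (x i - y i) * p + y i * (p - q) by ring.
apply: le_trans (ler_normD _ _) _; rewrite !normrM.
have h1 : `|x i - y i| * `|p| <= t * B ^+ size r by apply: ler_pM.
have h2 : `|y i| * `|p - q| <= B * ((size r)%:R * B ^+ size r * t).
  by case/andP: (hy i) => ? ?; apply: ler_pM => //; rewrite ger0_norm.
have h3 : t * B ^+ size r <= t * (B * B ^+ size r).
  by apply: ler_wpM2l => //; rewrite ler_peMl ?exprn_ge0.
rewrite -natr1; nra.
Qed.

Lemma le_limit0 (R : realType) (a b C : R) :
  (forall t, 0 < t <= 1 -> a <= b + C * t) -> a <= b.
Proof.
move=> h; rewrite leNgt; apply/negP => ba.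
pose D := Num.max C 1; have D1 : 1 <= D by rewrite le_max lexx orbT.
have CD : C <= D by rewrite le_max lexx.
pose t := Num.min 1 ((a - b) / (2 * D)).
have t0 : 0 < t by rewrite lt_min ltr01 divr_gt0//; lra.
have t1 : t <= 1 by rewrite ge_min lexx.
have tD : D * t <= (a - b) / 2.
  have -> : (a - b) / 2 = D * ((a - b) / (2 * D)) by field; lra.
  by apply: ler_wpM2l; [lra | rewrite ge_min lexx orbT].
have := h t; rewrite t0 t1 => /(_ isT); nra.
Qed.

Lemma map_measure_exists d d' (X : measurableType d) (Y : measurableType d') (R : realType)
    (m : {measure set X -> \bar R}) (h : X -> Y) : measurable_fun setT h ->
  exists m2 : {measure set Y -> \bar R}, forall A, m2 A = m (h @^-1` A).
Proof.
move=> mh.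
by unshelve refine (ex_intro _ (pushforward m h : {measure set Y -> \bar R}) _).
Qed.

Lemma measurable_cbox (R : realType) (n : nat) (a b : 'rV[R]_n.+1) :
  measurable [set x : Rd R n | forall i, a 0 i <= x 0 i <= b 0 i].
Proof.
have -> : [set x : Rd R n | forall i, a 0 i <= x 0 i <= b 0 i] =
    \bigcap_(i in [set: 'I_n.+1])
    ((fun x : Rd R n => x 0 i) @^-1` [set` `[a 0 i, b 0 i]%R]).
  apply/seteqP; split => x.
    by move=> h i _ /=; rewrite in_itv /=; exact: h.
  by move=> h i; have := h i I; rewrite /= in_itv.
apply: fin_bigcap_measurable => // i _; rewrite -[X in measurable X]setTI.
exact: measurable_coord.
Qed.

Lemma lebesgue_hbox (R : realType) (n : nat) (leb : {measure set (Rd R n) -> \bar R})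
    (a b : 'rV[R]_n.+1) : is_lebesgue leb ->
  leb (hbox a b) = (\prod_(i < n.+1) Num.max (b 0 i - a 0 i) 0)%:E.
Proof.
move=> Hleb; set p := \prod_(i < _) _.
have up : (leb (hbox a b) <= p%:E)%E.
  rewrite /p -Hleb; apply: le_measure; rewrite ?inE.
  - exact: measurable_hbox.
  - exact: measurable_cbox.
  - by move=> x h i; have /andP[-> /ltW ->] := h i.
apply/eqP; rewrite eq_le up /=.
have fin : leb (hbox a b) \is a fin_num.
  by rewrite ge0_fin_numE//; apply: le_lt_trans up _; rewrite ltry.
rewrite -(fineK fin) lee_fin.
pose B := 1 + \sum_(i < n.+1) `|b 0 i - a 0 i|.
have Bi i : `|b 0 i - a 0 i| <= B.
  rewrite /B (bigD1 i)//= addrCA lerDl addr_ge0// sumr_ge0//.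
have B1 : 1 <= B by rewrite /B lerDl sumr_ge0.
apply: (@le_limit0 _ _ _ (n.+1%:R * B ^+ n.+1)) => t /andP[t0 t1].
(* The closed box with upper corner lowered by [t] lies inside the half-open one; its volume differs
   from [p] by a multiple of [t]. *)
pose q := \prod_(i < n.+1) Num.max ((b 0 i - t) - a 0 i) 0.
have lo : q <= fine (leb (hbox a b)).
  rewrite -lee_fin fineK//.
  have := Hleb a (\row_i (b 0 i - t)).
  under eq_bigr do rewrite mxE.
  move=> <-; apply: le_measure; rewrite ?inE.
  - exact: measurable_cbox.
  - exact: measurable_hbox.
  - by move=> x h i; have := h i; rewrite mxE => /andP[-> ?] /=; lra.
apply: le_trans (lerD lo (lexx _)).
rewrite -lerBlDl; apply: le_trans (ler_norm _) _.
have := @prod_dist_le R 'I_n.+1 (index_enum 'I_n.+1)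
  (fun i => Num.max (b 0 i - a 0 i) 0) (fun i => Num.max ((b 0 i - t) - a 0 i) 0) B t B1.
have -> : size (index_enum 'I_n.+1) = n.+1.
  by rewrite -[RHS](card_ord n.+1) cardT enumT.
apply.
- move=> i; rewrite le_max lexx orbT /= ge_max; have := Bi i.
  by rewrite ler_norml => /andP[_ ->]; lra.
- move=> i; rewrite le_max lexx orbT /= ge_max; have := Bi i.
  by rewrite ler_norml => /andP[_ ?]; apply/andP; split; lra.
- move=> i; case: (leP (b 0 i - a 0 i) 0) => ?; case: (leP (b 0 i - t - a 0 i) 0) => ?;
    by rewrite ler_norml; apply/andP; split; lra.
Qed.

(** * Translation-invariant measures and volume scaling *)

Lemma lebesgue_translation (R : realType) (n : nat)
    (leb : {measure set (Rd R n) -> \bar R}) (v : 'rV[R]_n.+1) (E : set (Rd R n)) :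
  is_lebesgue leb -> measurable E -> leb [set x : Rd R n | E (x + v : Rd R n)] = leb E.
Proof.
move=> Hleb mE; have [m mP] := map_measure_exists leb (measurable_translation v).
have -> : leb [set x : Rd R n | E (x + v : Rd R n)] = m E by rewrite mP.
apply: hbox_measure_unique mE => a b; last first.
  rewrite mP (_ : _ @^-1` _ = hbox (a - v) (b - v)) ?lebesgue_hbox ?ltry//.
  by apply/seteqP; split => x h i; have := h i; rewrite !mxE; lra.
rewrite mP (_ : _ @^-1` _ = hbox (a - v) (b - v)); last first.
  by apply/seteqP; split => x h i; have := h i; rewrite !mxE; lra.
rewrite !lebesgue_hbox//; congr EFin; apply: eq_bigr => i _; rewrite !mxE.
by congr (Num.max _ _); ring.
Qed.

(** Cauchy's functional equation with positivity, which gives monotonicity. Comparing [k * s] with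
    its integer part bounds [k * (g s - s * g 1)] by [g 1] uniformly in [k]. *)
Lemma additive_linear (R : realType) (g : R -> R) :
  (forall s, 0 <= s -> 0 <= g s) ->
  (forall s t, 0 <= s -> 0 <= t -> g (s + t) = g s + g t) ->
  forall s, 0 <= s -> g s = s * g 1.
Proof.
move=> g0 gD s s0.
have gn (k : nat) r : 0 <= r -> g (k%:R * r) = k%:R * g r.
  move=> r0; elim: k => [|k IH].
    have := gD 0 0 (lexx 0) (lexx 0); rewrite addr0 !mul0r; lra.
  by rewrite -natr1 mulrDl mul1r gD ?mulr_ge0// IH mulrDl mul1r.
have g1 : 0 <= g 1 by exact: g0.
have mono r t : 0 <= r -> r <= t -> g r <= g t.
  move=> r0 rt; have -> : t = r + (t - r) by ring.
  by rewrite gD ?subr_ge0// lerDl g0// subr_ge0.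
have key (k : nat) : `|k%:R * (g s - s * g 1)| <= g 1.
  have ks0 : 0 <= k%:R * s by rewrite mulr_ge0.
  have /andP[h1 h2] := truncn_itv ks0; set p := Num.truncn (k%:R * s) in h1 h2.
  have l1 : p%:R * g 1 <= k%:R * g s.
    by rewrite -(gn k s s0) -(gn p 1 ler01) mulr1; exact: mono.
  have l2 : k%:R * g s <= p.+1%:R * g 1.
    by rewrite -(gn k s s0) -(gn p.+1 1 ler01) mulr1; apply: mono => //; exact: ltW.
  rewrite -natr1 in h2 l2; rewrite ler_norml; apply/andP; split; nra.
apply/eqP; rewrite -subr_eq0 -normr_le0 leNgt; apply/negP => pos.
have := key (Num.bound (g 1 / `|g s - s * g 1|)).
rewrite normrM ger0_norm// leNgt => /negP; apply.
have : 0 <= g 1 / `|g s - s * g 1| by rewrite divr_ge0.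
by move=> /archi_boundP; rewrite ltr_pdivrMr.
Qed.

(** Cutting a box and translating one piece back to the origin shows that its measure is additive in
    each side length, hence linear in each. Changing the sides one by one from 1 to their values
    yields the product. *)
Lemma translation_invariant_hbox (R : realType) (n : nat)
    (m : {measure set (Rd R n) -> \bar R}) :
  (forall v (E : set (Rd R n)), measurable E -> m [set x : Rd R n | E (x + v : Rd R n)] = m E) ->
  (forall a b, (m (hbox a b) < +oo)%E) ->
  forall a b, m (hbox a b) =
    (fine (m (hbox 0 (const_mx 1))) * \prod_(i < n.+1) Num.max (b 0 i - a 0 i) 0)%:E.
Proof.
move=> mtr mfin a b.
pose ub (l : 'I_n.+1 -> R) := hbox 0 (\row_i l i) : set (Rd R n).
have ubfin l : m (ub l) \is a fin_num.
  by rewrite ge0_fin_numE; [exact: mfin | exact: measure_ge0].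
pose H l := fine (m (ub l)).
pose upd (l : 'I_n.+1 -> R) i s := fun j => if j == i then s else l j.
have HD l i s t : 0 <= s -> 0 <= t ->
    H (upd l i (s + t)) = H (upd l i s) + H (upd l i t).
  move=> s0 t0; apply: EFin_inj; rewrite EFinD !fineK//.
  pose v : 'rV[R]_n.+1 := \row_j if j == i then - s else 0.
  rewrite -(mtr v (ub (upd l i t))); last exact: measurable_hbox.
  have mub l' : measurable (ub l') by exact: measurable_hbox.
  rewrite -measureU//.
  - congr (m _); apply/seteqP; split => [x h|x [h|h] j].
    + have [xs|xs] := ltP (x 0 i) s; [left|right] => j; have := h j.
        by rewrite !mxE /upd; case: eqP => [->|]//; lra.
      by rewrite !mxE /upd; case: eqP => [->|]; rewrite ?addr0//; lra.
    + by have := h j; rewrite !mxE /upd; case: eqP => //; lra.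
    + by have := h j; rewrite !mxE /upd; case: eqP => //; rewrite ?addr0//; lra.
  - have := measurable_translation v measurableT (mub (upd l i t)).
    by rewrite setTI.
  - rewrite -subset0 => x [h1 h2]; have := h1 i; have := h2 i.
    by rewrite !mxE /upd eqxx; lra.
have H0 l : 0 <= H l by exact: fine_ge0.
have Hlin l i s : 0 <= s -> H (upd l i s) = s * H (upd l i 1).
  by move=> s0; apply: (@additive_linear _ (fun s => H (upd l i s))) => // *; exact: HD.
have Hprod l (r : seq 'I_n.+1) : uniq r -> (forall i, 0 <= l i) ->
    H (fun j => if j \in r then l j else 1) = (\prod_(j <- r) l j) * H (fun=> 1).
  move=> + l0; elim: r => [_|i r IH /= /andP[ir ur]].
    by rewrite big_nil mul1r; congr H; apply/funext => j.
  rewrite big_cons -mulrA -IH//.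
  set f := fun j => if j \in r then l j else 1.
  have -> : (fun j => if j \in i :: r then l j else 1) = upd f i (l i).
    apply/funext => j; rewrite /upd inE; by case: eqP => [->|].
  rewrite Hlin//; congr (_ * H _); apply/funext => j; rewrite /upd /f.
  by case: eqP => [->|//]; rewrite (negbTE ir).
have -> : m (hbox a b) = m (ub (fun i => b 0 i - a 0 i)).
  rewrite -(mtr a (hbox a b)); last exact: measurable_hbox.
  by congr (m _); apply/seteqP; split => x h i; have := h i; rewrite !mxE; lra.
have [neg|pos] := pselect (exists i, b 0 i - a 0 i < 0).
  have [i hi] := neg; have -> : ub (fun i => b 0 i - a 0 i) = set0.
    by rewrite -subset0 => x h; have := h i; rewrite !mxE; lra.
  rewrite measure0 (bigD1 i)//= [Num.max _ _]max_r ?mul0r ?mulr0//; exact: ltW.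
have l0 i : 0 <= b 0 i - a 0 i.
  by rewrite leNgt; apply/negP => h; apply: pos; exists i.
rewrite -[LHS]fineK//; congr EFin; rewrite -/(H _).
have := Hprod (fun i => b 0 i - a 0 i) (index_enum _) (index_enum_uniq _) l0.
have -> : (fun j => if j \in index_enum 'I_n.+1 then b 0 j - a 0 j else 1) =
  (fun j => b 0 j - a 0 j) by apply/funext => j; rewrite mem_index_enum.
move=> ->; rewrite mulrC; congr (_ * _).
  by congr (fine (m (hbox _ _))); apply/rowP => j; rewrite !mxE.
by apply: eq_bigr => i _; rewrite max_l.
Qed.

(** The measured set is the preimage of the unit cube, so for invertible [M] this is the inverse of
    the absolute determinant. Only the lower bound is established below, since masses of balls are
    to be bounded from below. *)
Definition cvol {R : realType} {n : nat} (leb : {measure set (Rd R n) -> \bar R})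
  (M : 'M[R]_n.+1) : R :=
  fine (leb [set x : Rd R n | hbox 0 (const_mx 1) (x *m M : Rd R n)]).

Lemma mulmx_row_bound (R : realType) (n : nat) (M : 'M[R]_n.+1) (C : R) (y : 'rV[R]_n.+1) j :
  (forall k, `|y 0 k| <= C) -> `|(y *m M) 0 j| <= C * \sum_k `|M k j|.
Proof.
move=> yC; rewrite mxE mulr_sumr; apply: le_trans (ler_norm_sum _ _ _) _.
by apply: ler_sum => k _; rewrite normrM ler_wpM2r.
Qed.

Lemma hbox_preimage_lt_pinfty (R : realType) (n : nat)
    (leb : {measure set (Rd R n) -> \bar R}) (M : 'M[R]_n.+1) a b :
  is_lebesgue leb -> M \in unitmx ->
  (leb [set x : Rd R n | hbox a b (x *m M : Rd R n)] < +oo)%E.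
Proof.
move=> Hleb uM; pose C := \sum_k (`|a 0 k| + `|b 0 k|).
pose r : 'rV[R]_n.+1 := \row_j (C * \sum_k `|invmx M k j|).
apply: (@le_lt_trans _ _ (leb [set x : Rd R n | forall i, (- r) 0 i <= x 0 i <= r 0 i])).
  apply: le_measure; rewrite ?inE.
  - rewrite -[X in measurable X]setTI.
    by apply: measurable_mulmx; [exact: measurableT | exact: measurable_hbox].
  - exact: measurable_cbox.
  - move=> x h i; rewrite !mxE -ler_norml -[x](mulmxK uM).
    apply: mulmx_row_bound => k; have := h k => /andP[h1 h2].
    have : `|a 0 k| + `|b 0 k| <= C.
      by rewrite /C (bigD1 k)//= lerDl sumr_ge0// => j _; rewrite addr_ge0.
    have := ler_norm (- a 0 k); have := ler_norm (b 0 k); rewrite normrN.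
    have := normr_ge0 (a 0 k); have := normr_ge0 (b 0 k).
    by rewrite ler_norml; lra.
by rewrite Hleb ltry.
Qed.

(** Preimages under [M] turn a translation by [v] into one by [v *m invmx M], so the image measure
    is again translation invariant, hence a multiple of Lebesgue measure. *)
Lemma lebesgue_mulmx (R : realType) (n : nat)
    (leb : {measure set (Rd R n) -> \bar R}) (M : 'M[R]_n.+1) (E : set (Rd R n)) :
  is_lebesgue leb -> M \in unitmx -> measurable E ->
  leb [set x : Rd R n | E (x *m M : Rd R n)] = ((cvol leb M)%:E * leb E)%E.
Proof.
move=> Hleb uM mE; have [m mP] := map_measure_exists leb (measurable_mulmx M).
have c0 : 0 <= cvol leb M by exact: fine_ge0.
have pre A : measurable A -> measurable [set x : Rd R n | A (x *m M : Rd R n)].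
  by move=> mA; rewrite -[X in measurable X]setTI; apply: measurable_mulmx.
have mfin a b : (m (hbox a b) < +oo)%E.
  by rewrite mP; exact: hbox_preimage_lt_pinfty.
have mtr v (A : set (Rd R n)) : measurable A -> m [set x : Rd R n | A (x + v : Rd R n)] = m A.
  move=> mA; rewrite !mP.
  rewrite -[RHS](lebesgue_translation (v *m invmx M) Hleb (pre _ mA)).
  by congr (leb _); apply/seteqP; split => x /=; rewrite mulmxDl mulmxKV.
have := @hbox_measure_unique R n m (mscale (NngNum c0) leb) _ mfin E mE.
rewrite mP => -> // a b; rewrite (translation_invariant_hbox mtr mfin) EFinM mP.
by rewrite -(lebesgue_hbox a b Hleb).
Qed.

Lemma cvol_mulmx (R : realType) (n : nat) (leb : {measure set (Rd R n) -> \bar R})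
    (M N : 'M[R]_n.+1) : is_lebesgue leb -> M \in unitmx -> N \in unitmx ->
  cvol leb (M *m N) = cvol leb M * cvol leb N.
Proof.
move=> Hleb uM uN; rewrite {1}/cvol.
have -> : [set x : Rd R n | hbox 0 (const_mx 1) (x *m (M *m N) : Rd R n)] =
   [set x : Rd R n | [set y : Rd R n | hbox 0 (const_mx 1) (y *m N : Rd R n)] (x *m M : Rd R n)].
  by apply/seteqP; split => x /=; rewrite mulmxA.
rewrite lebesgue_mulmx//; last first.
  rewrite -[X in measurable X]setTI.
  by apply: measurable_mulmx; [exact: measurableT | exact: measurable_hbox].
rewrite fineM// ge0_fin_numE; first exact: hbox_preimage_lt_pinfty.
exact: measure_ge0.
Qed.

Lemma cvol1 (R : realType) (n : nat) (leb : {measure set (Rd R n) -> \bar R}) :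
  is_lebesgue leb -> cvol leb 1%:M = 1.
Proof.
move=> Hleb; rewrite /cvol.
have -> : [set x : Rd R n | hbox 0 (const_mx 1) (x *m 1%:M : Rd R n)] = hbox 0 (const_mx 1).
  by apply/seteqP; split => x /=; rewrite mulmx1.
rewrite lebesgue_hbox//= big1// => i _; rewrite !mxE subr0 max_l//; exact: ler01.
Qed.

Lemma cvol_invmx (R : realType) (n : nat) (leb : {measure set (Rd R n) -> \bar R})
    (M : 'M[R]_n.+1) : is_lebesgue leb -> M \in unitmx ->
  cvol leb M * cvol leb (invmx M) = 1.
Proof. by move=> Hleb uM; rewrite -cvol_mulmx ?unitmx_inv// mulmxV// cvol1. Qed.

Lemma cvol_perm (R : realType) (n : nat) (leb : {measure set (Rd R n) -> \bar R})
    (s : 'S_n.+1) : is_lebesgue leb -> cvol leb (perm_mx s) = 1.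
Proof.
move=> Hleb; rewrite -(cvol1 Hleb) /cvol; congr (fine (leb _)).
have E (x : 'rV[R]_n.+1) i : (x *m perm_mx s) 0 (s i) = x 0 i.
  by rewrite -[X in _ *m perm_mx X]invgK -col_permE mxE permK.
apply/seteqP; split => x /=; rewrite mulmx1 => h i.
  by have := h (s i); rewrite E !mxE.
by have := h ((s^-1)%g i); rewrite -(E x) permKV !mxE.
Qed.

(* Conjugating by [diag (t ^ rk i)] and letting [t] tend to 0 degenerates a
   triangular matrix to its diagonal without changing [cvol]. *)
Lemma cvol_triangular (R : realType) (n : nat) (leb : {measure set (Rd R n) -> \bar R})
    (M : 'M[R]_n.+1) (rk : 'I_n.+1 -> nat) :
  is_lebesgue leb -> M \in unitmx ->
  (forall i j, i != j -> M i j != 0 -> (rk j < rk i)%N) ->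
  cvol leb (invmx M) <= \prod_i `|M i i|.
Proof.
move=> Hleb uM tri.
pose B := 1 + \sum_i \sum_j `|M i j|.
have MB i j : `|M i j| <= B.
  rewrite /B (bigD1 i)//= (bigD1 j)//=.
  have : 0 <= \sum_(i0 < n.+1 | i0 != j) `|M i i0| by exact: sumr_ge0.
  have : 0 <= \sum_(i0 < n.+1 | i0 != i) \sum_(j0 < n.+1) `|M i0 j0|.
    by apply: sumr_ge0 => k _; exact: sumr_ge0.
  lra.
have B1 : 1 <= B.
  by rewrite /B lerDl; apply: sumr_ge0 => k _; exact: sumr_ge0.
pose L := 3 * (n.+1%:R * B).
have nB : B <= n.+1%:R * B by rewrite ler_peMl ?ler1n//; lra.
have L1 : B + L + 1 <= 5 * (n.+1%:R * B) by rewrite /L; lra.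
apply: (@le_limit0 _ _ _ (n.+1%:R * (5 * (n.+1%:R * B)) ^+ n.+1 * L)) => t /andP[t0 t1].
have tn0 : t != 0 by rewrite gt_eqF.
pose d : 'rV[R]_n.+1 := \row_i t ^+ rk i; pose d' : 'rV[R]_n.+1 := \row_i (t ^+ rk i)^-1.
have dd' : diag_mx d *m diag_mx d' = 1%:M.
  rewrite mulmx_diag; apply/matrixP => i j; rewrite !mxE.
  by case: eqP => // ->; rewrite mulr1n mulfV// expf_neq0.
have [ud _] := mulmx1_unit dd'.
have [_ ud'] := mulmx1_unit dd'.
(* The entry at [i, j] is multiplied by [t ^ rk i / t ^ rk j]. Nonzero off-diagonal entries have
   [rk j < rk i], so they shrink by at least the factor [t], while the diagonal is unchanged. *)
pose Mt := diag_mx d *m M *m diag_mx d'.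
have uMt : Mt \in unitmx by rewrite !unitmx_mul ud uM ud'.
have cMt : cvol leb (invmx M) = cvol leb (invmx Mt).
  have c1 := cvol_invmx Hleb uM; have c2 := cvol_invmx Hleb uMt.
  have cE : cvol leb Mt = cvol leb M.
    rewrite /Mt !cvol_mulmx// ?unitmx_mul ?ud//.
    have : cvol leb (diag_mx d) * cvol leb (diag_mx d') = 1 by rewrite -cvol_mulmx// dd' cvol1.
    move=> h; rewrite mulrAC h mul1r//.
  rewrite cE in c2.
  have c0 : cvol leb M != 0 by apply: contra_eq_neq c1 => ->; rewrite mul0r eq_sym oner_neq0.
  by apply: (mulfI c0); rewrite c1 c2.
have Mtd i : Mt i i = M i i.
  rewrite /Mt mul_mx_diag mul_diag_mx !mxE mulrAC mulfV ?mul1r// expf_neq0//.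
have Mtoff i j : i != j -> `|Mt i j| <= t * B.
  move=> ij; rewrite /Mt mul_mx_diag mul_diag_mx !mxE.
  have [->|Mij] := eqVneq (M i j) 0; first by rewrite mulr0 mul0r normr0 mulr_ge0//; lra.
  have rkij := tri _ _ ij Mij.
  have -> : t ^+ rk i * M i j / t ^+ rk j = t ^+ (rk i - rk j) * M i j.
    by rewrite mulrAC -expfB// ltnW.
  rewrite normrM; apply: ler_pM => //.
  rewrite ger0_norm; last by rewrite exprn_ge0// ltW.
  by rewrite -[leRHS]expr1; apply: ler_wiXn2l; rewrite ?subn_gt0// ltW.
rewrite cMt /cvol.
(* The measured set is the image of the unit cube under [Mt]. In coordinate [j] it stays within
   [n.+1 * t * B] of the segment between 0 and [M j j]. *)
pose lo : 'rV[R]_n.+1 := \row_j (Num.min (M j j) 0 - n.+1%:R * (t * B)).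
pose hi : 'rV[R]_n.+1 := \row_j (Num.max (M j j) 0 + n.+1%:R * (t * B)).
have sub : [set x : Rd R n | hbox 0 (const_mx 1) (x *m invmx Mt : Rd R n)] `<=`
    [set x : Rd R n | forall i, lo 0 i <= x 0 i <= hi 0 i].
  move=> x h j; rewrite -[x](mulmxKV uMt); set y := x *m invmx Mt in h *.
  have y01 k : 0 <= y 0 k <= 1 by have := h k; rewrite !mxE; lra.
  have : `|(y *m Mt) 0 j - y 0 j * M j j| <= n.+1%:R * (t * B).
    rewrite mxE (bigD1 j)//= Mtd addrAC subrr add0r.
    apply: le_trans (ler_norm_sum _ _ _) _.
    apply: (@le_trans _ _ (\sum_(i < n.+1 | i != j) t * B)).
      apply: ler_sum => k kj; rewrite normrM -[leRHS]mul1r; apply: ler_pM => //.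
        by rewrite ger0_norm; case/andP: (y01 k).
      exact: Mtoff.
    rewrite sumr_const mulr_natl; apply: ler_wpMn2l; first by rewrite mulr_ge0//; lra.
    by apply: leq_trans (max_card _) _; rewrite card_ord.
  have loE : lo 0 j = Num.min (M j j) 0 - n.+1%:R * (t * B) by rewrite mxE.
  have hiE : hi 0 j = Num.max (M j j) 0 + n.+1%:R * (t * B) by rewrite mxE.
  rewrite loE hiE ler_norml => /andP[h1 h2].
  have /andP[y0 y1] := y01 j.
  have m1 : Num.min (M j j) 0 <= y 0 j * M j j.
    by case: (leP (M j j) 0) => h0; nra.
  have m2 : y 0 j * M j j <= Num.max (M j j) 0.
    by case: (leP (M j j) 0) => h0; nra.
  apply/andP; split; lra.
have fin : leb [set x : Rd R n | hbox 0 (const_mx 1) (x *m invmx Mt : Rd R n)] \is a fin_num.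
  rewrite ge0_fin_numE; last exact: measure_ge0.
  by apply: hbox_preimage_lt_pinfty => //; rewrite unitmx_inv.
have le1 : cvol leb (invmx Mt) <= \prod_(i < n.+1) Num.max (hi 0 i - lo 0 i) 0.
  rewrite -lee_fin /cvol fineK// -Hleb; apply: le_measure => //; rewrite inE.
  - rewrite -[X in measurable X]setTI.
    by apply: measurable_mulmx; [exact: measurableT | exact: measurable_hbox].
  - exact: measurable_cbox.
apply: le_trans le1 _; rewrite -lerBlDl; apply: le_trans (ler_norm _) _.
have tB : 0 <= t * (n.+1%:R * B) <= n.+1%:R * B.
  by apply/andP; split; [rewrite mulr_ge0//; lra | rewrite ler_piMl//; lra].
have hl i : Num.max (hi 0 i - lo 0 i) 0 = `|M i i| + 2 * (t * (n.+1%:R * B)).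
  rewrite !mxE mulrCA max_l; last by case: (leP (M i i) 0) => h; lra.
  by case: (leP (M i i) 0) => h; [rewrite ler0_norm//|rewrite gtr0_norm//]; lra.
have := @prod_dist_le R 'I_n.+1 (index_enum 'I_n.+1)
  (fun i => Num.max (hi 0 i - lo 0 i) 0) (fun i => `|M i i|) (5 * (n.+1%:R * B)) (L * t).
have -> : size (index_enum 'I_n.+1) = n.+1.
  by rewrite -[RHS](card_ord n.+1) cardT enumT.
move=> h; rewrite -[leRHS]mulrA; apply: h.
- lra.
- by move=> i; rewrite hl; have := MB i i; have := normr_ge0 (M i i); lra.
- by move=> i; have := MB i i; have := normr_ge0 (M i i); lra.
- move=> i; rewrite hl addrAC subrr add0r ger0_norm; last lra.
  by rewrite /L; lra.
Qed.

(** In the LUP decomposition the permutation preserves volume. For each triangular factor the upper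
    bound on [cvol] of the inverse becomes a lower bound on [cvol] of the factor, because the two
    multiply to 1. *)
Lemma lebesgue_mulmx_ge (R : realType) (n : nat)
    (leb : {measure set (Rd R n) -> \bar R}) (M : 'M[R]_n.+1) (E : set (Rd R n)) :
  is_lebesgue leb -> M \in unitmx -> measurable E ->
  ((`|\det M|^-1)%:E * leb E <= leb [set x : Rd R n | E (x *m M : Rd R n)])%E.
Proof.
move=> Hleb uM mE; rewrite lebesgue_mulmx//; apply: lee_wpmul2r => //.
rewrite lee_fin.
have := cormen_lup_correct M; have := cormen_lup_perm M.
have := cormen_lup_detL M; have := cormen_lup_lower M; have := cormen_lup_upper M.
case: cormen_lup => [[P L] U] /= Uup Llo detL /is_perm_mxP [s ->] PM0.
have PM : perm_mx s *m M = L *m U := PM0.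
have uL : L \in unitmx by rewrite unitmxE detL unitr1.
have uU : U \in unitmx.
  have : perm_mx s *m M \in unitmx by rewrite unitmx_mul unitmx_perm.
  by rewrite PM unitmx_mul => /andP[].
have dM : `|\det M| = \prod_i `|U i i|.
  have := congr1 (fun X => `|\det X|) PM.
  rewrite !det_mulmx detL mul1r normrM det_perm normr_sign mul1r => ->.
  have UT : is_trig_mx U^T by apply/is_trig_mxP => i j ij; rewrite mxE Uup.
  rewrite -det_tr det_trig// normr_prod.
  by apply: eq_bigr => i _; rewrite mxE.
have c1 : cvol leb M = cvol leb L * cvol leb U.
  by rewrite -cvol_mulmx// -PM cvol_mulmx ?unitmx_perm// cvol_perm// mul1r.
have L1 : 1 <= cvol leb L.
  have le1 : cvol leb (invmx L) <= 1.
    have -> : 1 = \prod_(i < n.+1) `|L i i|.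
      by rewrite big1// => i _; rewrite Llo// eqxx normr1.
    apply: (cvol_triangular (rk := fun i => i)) => // i j ij; apply: contraNltn => ji.
    by rewrite Llo// (negbTE ij).
  have := cvol_invmx Hleb uL; have : 0 <= cvol leb L by exact: fine_ge0.
  nra.
have U1 : (\prod_i `|U i i|)^-1 <= cvol leb U.
  have le1 : cvol leb (invmx U) <= \prod_i `|U i i|.
    (* The rank is reversed, as the nonzero off-diagonal entries of [U] have the column index above
       the row index. *)
    apply: (cvol_triangular (rk := fun i => n - i)%N) => // i j ij; apply: contraNltn => ji.
    rewrite Uup// ltn_neqAle eq_sym ij /=.
    have := ltn_ord i; have := ltn_ord j; rewrite !ltnS => hj hi.
    by rewrite -(subKn hi) -(subKn hj) leq_sub2l.
  have pp : 0 < \prod_i `|U i i|.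
    by rewrite -dM normr_gt0 -unitfE -unitmxE.
  have := cvol_invmx Hleb uU; have : 0 <= cvol leb U by exact: fine_ge0.
  move=> c0 cc; rewrite -[leLHS]mul1r ler_pdivrMr//.
  by have := ler_wpM2l c0 le1; rewrite cc.
rewrite dM c1; apply: le_trans U1 _; rewrite ler_peMl//; exact: fine_ge0.
Qed.

(** * Rayleigh quotients *)

Definition qform {R : realType} {m : nat} (D : 'M[R]_m) (v w : 'rV[R]_m) : R :=
  (v *m D *m w^T) 0 0.

Lemma qformE (R : realType) (m : nat) (D : 'M[R]_m) (v w : 'rV[R]_m) :
  qform D v w = \sum_i \sum_j v 0 i * D i j * w 0 j.
Proof.
rewrite /qform mxE exchange_big /=; apply: eq_bigr => j _.
by rewrite !mxE mulr_suml.
Qed.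

Lemma qformDl (R : realType) (m : nat) (D : 'M[R]_m) (u v w : 'rV[R]_m) :
  qform D (u + v) w = qform D u w + qform D v w.
Proof. by rewrite /qform !mulmxDl mxE. Qed.

Lemma qformZl (R : realType) (m : nat) (D : 'M[R]_m) (t : R) (v w : 'rV[R]_m) :
  qform D (t *: v) w = t * qform D v w.
Proof. by rewrite /qform -!scalemxAl mxE. Qed.

Lemma qform_sym (R : realType) (m : nat) (D : 'M[R]_m) (v w : 'rV[R]_m) :
  D^T = D -> qform D v w = qform D w v.
Proof.
move=> DT; rewrite /qform.
have -> : w *m D *m v^T = (v *m D *m w^T)^T by rewrite !trmx_mul trmxK DT mulmxA.
by rewrite [RHS]mxE.
Qed.

Lemma qform_sqrD (R : realType) (m : nat) (D : 'M[R]_m) (t : R) (v w : 'rV[R]_m) :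
  D^T = D -> qform D (v + t *: w) (v + t *: w) =
    qform D v v + 2 * t * qform D v w + t ^+ 2 * qform D w w.
Proof.
move=> DT; rewrite qformDl qformZl (qform_sym v _ DT) (qform_sym w _ DT) !qformDl !qformZl.
by rewrite (qform_sym w v DT); ring.
Qed.

Lemma qform_cauchy_schwarz (R : realType) (m : nat) (D : 'M[R]_m) (v w : 'rV[R]_m) :
  D^T = D -> (forall u, 0 <= qform D u u) ->
  qform D v w ^+ 2 <= qform D v v * qform D w w.
Proof.
move=> DT psd; set a := qform D v v; set b := qform D v w; set c := qform D w w.
have quad t : 0 <= a + 2 * t * b + t ^+ 2 * c by rewrite -qform_sqrD.
have a0 : 0 <= a by exact: psd.
have c0 : 0 <= c by exact: psd.
have [c00|cn0] := eqVneq c 0.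
  have [b0|bn0] := eqVneq b 0; first by rewrite b0 expr0n /= mulr_ge0.
  (* With [c = 0] the quadratic is affine in [t], and this [t] gives it the value -1. *)
  have := quad (- (a + 1) / (2 * b)); rewrite c00 mulr0 addr0.
  have -> : 2 * (- (a + 1) / (2 * b)) * b = - (a + 1) by field.
  lra.
have cp : 0 < c by rewrite lt_neqAle eq_sym cn0.
have := quad (- b / c).
have -> : a + 2 * (- b / c) * b + (- b / c) ^+ 2 * c = (a * c - b ^+ 2) / c by field.
by rewrite pmulr_lge0 ?invr_gt0// subr_ge0.
Qed.

Lemma qform1E (R : realType) (m : nat) (v : 'rV[R]_m) :
  qform 1%:M v v = \sum_i v 0 i ^+ 2.
Proof. by rewrite /qform mulmx1 mxE; apply: eq_bigr => i _; rewrite mxE -expr2. Qed.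

Lemma qform1_eq0 (R : realType) (m : nat) (v : 'rV[R]_m) : qform 1%:M v v = 0 -> v = 0.
Proof.
rewrite qform1E => /eqP; rewrite psumr_eq0; last by move=> i _; exact: sqr_ge0.
move=> /allP h; apply/rowP => i; rewrite mxE; apply/eqP.
by have := h i; rewrite mem_index_enum sqrf_eq0 => /(_ isT).
Qed.

Lemma qform_bound (R : realType) (m : nat) (D : 'M[R]_m) :
  exists2 C : R, 0 < C & forall v, qform D v v <= C * qform 1%:M v v.
Proof.
exists (1 + \sum_i \sum_j `|D i j|).
  rewrite ltr_pwDl//; apply: sumr_ge0 => i _; exact: sumr_ge0.
move=> v; set N := qform 1%:M v v.
have N0 : 0 <= N by rewrite /N qform1E; apply: sumr_ge0 => i _; exact: sqr_ge0.
have vN i : v 0 i ^+ 2 <= N.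
  by rewrite /N qform1E (bigD1 i)//= lerDl; apply: sumr_ge0 => k _; exact: sqr_ge0.
have vvN i j : `|v 0 i * v 0 j| <= N.
  have := vN i; have := vN j; have := sqr_ge0 (v 0 i - v 0 j).
  have := sqr_ge0 (v 0 i + v 0 j); rewrite !expr2 ler_norml; lra.
rewrite mulrDl mul1r qformE -[leLHS]add0r; apply: lerD => //.
rewrite mulr_suml; apply: ler_sum => i _; rewrite mulr_suml; apply: ler_sum => j _.
apply: le_trans (ler_norm _) _; rewrite mulrAC normrM mulrC.
exact: ler_wpM2l.
Qed.

(* At the supremum [M] of the Rayleigh quotient, [M%:M - A] is positive
   semidefinite; were it invertible, Cauchy-Schwarz for its quadratic form would
   bound it below and contradict the choice of [M]. *)
Lemma rayleigh_lambda_max (R : realType) (n : nat) (A : 'M[R]_n.+1) (w : 'rV[R]_n.+1) :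
  A^T = A -> qform A w w <= lambda_max A * qform 1%:M w w.
Proof.
move=> AT.
pose Q := [set r : R | exists2 v : 'rV[R]_n.+1, qform 1%:M v v = 1 & r = qform A v v].
have [C C0 hC] := qform_bound A.
have Qne : Q !=set0.
  exists (qform A (delta_mx 0 0) (delta_mx 0 0)); exists (delta_mx 0 0) => //.
  rewrite qform1E (bigD1 ord0)//= big1 ?addr0; last first.
    by move=> i i0; rewrite mxE (negbTE i0) andbF expr0n.
  by rewrite mxE !eqxx expr1n.
have Qub : ubound Q C by move=> _ [v v1 ->]; have := hC v; rewrite v1 mulr1.
have hsQ : has_sup Q by split => //; exists C.
pose M := sup Q.
have norm0 (v : 'rV[R]_n.+1) : v != 0 -> 0 < qform 1%:M v v.
  move=> v0; rewrite lt_neqAle eq_sym; apply/andP; split.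
    by apply: contra_neq v0; exact: qform1_eq0.
  by rewrite qform1E; apply: sumr_ge0 => i _; exact: sqr_ge0.
have homog (c : R) : (forall r, Q r -> r <= c) ->
    forall v, qform A v v <= c * qform 1%:M v v.
  move=> Qc v; have [->|v0] := eqVneq v 0.
    by rewrite /qform !mul0mx mxE mulr0.
  have N0 := norm0 v v0; set N := qform 1%:M v v in N0 *.
  have s2 : (Num.sqrt N)^-1 ^+ 2 = N^-1 by rewrite exprVn sqr_sqrtr// ltW.
  have qs (D : 'M[R]_n.+1) : D^T = D -> qform D ((Num.sqrt N)^-1 *: v) ((Num.sqrt N)^-1 *: v) = N^-1 * qform D v v.
    by move=> DT; rewrite qformZl (qform_sym _ _ DT) qformZl mulrA -expr2 s2.
  have : qform A ((Num.sqrt N)^-1 *: v) ((Num.sqrt N)^-1 *: v) <= c.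
    apply: Qc; exists ((Num.sqrt N)^-1 *: v) => //.
    by rewrite qs ?trmx1// -/N mulVf// gt_eqF.
  by rewrite qs// mulrC ler_pdivrMr.
have hM : forall v, qform A v v <= M * qform 1%:M v v.
  by apply: homog => r Qr; apply: ub_le_sup => //; exists C.
pose B := M%:M - A.
have BT : B^T = B by rewrite /B linearB /= tr_scalar_mx AT.
have BE v : qform B v v = M * qform 1%:M v v - qform A v v.
  rewrite /qform /B mulmxBr mulmxBl mxE [X in _ + X]mxE; congr (_ - _).
  by rewrite mul_mx_scalar mulmx1 -scalemxAl mxE.
have Bpsd u : 0 <= qform B u u by rewrite BE subr_ge0.
have nB : B \notin unitmx.
  apply/negP => uB; have [C' C'0 hC'] := qform_bound (invmx B).
  have : M <= M - C'^-1.
    rewrite {1}/M; apply: ge_sup => // r Qr.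
    have [v v1 ->] := Qr.
    (* These two vectors have [B]-product equal to the squared norm of [v], that is 1. Hence 1 is at
       most [C'] times [M - qform A v v], uniformly over unit vectors. *)
    have := qform_cauchy_schwarz (v *m invmx B) v BT Bpsd.
    have -> : qform B (v *m invmx B) v = 1 by rewrite /qform mulmxKV// -v1 /qform mulmx1.
    have -> : qform B (v *m invmx B) (v *m invmx B) = qform (invmx B) v v.
      rewrite /qform mulmxKV// trmx_mul mulmxA trmx_inv BT //.
    rewrite expr1n BE v1 mulr1 => h.
    have h1 := hC' v; rewrite v1 mulr1 in h1.
    have h2 : 0 <= M - qform A v v by rewrite subr_ge0; have := hM v; rewrite v1 mulr1.
    have h3 : 1 <= C' * (M - qform A v v) by apply: le_trans h _; exact: ler_wpM2r.
    suff : C'^-1 <= M - qform A v v by lra.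
    by rewrite -[leLHS]mul1r ler_pdivrMr// mulrC.
  have : 0 < C'^-1 by rewrite invr_gt0.
  lra.
have eM : eigenvalue A M.
  rewrite /eigenvalue /eigenspace kermx_eq0 row_free_unit.
  have -> : A - M%:M = - B by rewrite /B opprB.
  apply: contra nB; rewrite !unitmxE -scaleN1r detZ unitrM => /andP[_]; exact.
apply: le_trans (hM w) _; apply: ler_wpM2r.
  by rewrite qform1E; apply: sumr_ge0 => i _; exact: sqr_ge0.
(* [lambda_max] is a supremum, so membership of [M] helps only together with a bound on the set: the
   Rayleigh quotient of an eigenvector is its eigenvalue. *)
apply: ub_le_sup => //; exists M => r /eigenvalueP [v vA v0].
have := hM v; rewrite {1}/qform vA -scalemxAl mxE.
have -> : (v *m v^T) 0 0 = qform 1%:M v v by rewrite /qform mulmx1.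
by rewrite ler_pM2r// norm0.
Qed.

Lemma enormE (R : realType) (m : nat) (x : 'rV[R]_m) : enorm x = Num.sqrt (qform 1%:M x x).
Proof. by rewrite qform1E. Qed.

Lemma qform1_enorm (R : realType) (m : nat) (x : 'rV[R]_m) : qform 1%:M x x = enorm x ^+ 2.
Proof.
rewrite enormE sqr_sqrtr// qform1E; apply: sumr_ge0 => i _; exact: sqr_ge0.
Qed.

Lemma enorm_mulmx_sqrt (R : realType) (n : nat) (A S : 'M[R]_n.+1) (w : 'rV[R]_n.+1) :
  A^T = A -> S^T = S -> S *m S = A ->
  enorm (w *m S) <= Num.sqrt (lambda_max A) * enorm w.
Proof.
move=> AT ST SA.
have E : qform 1%:M (w *m S) (w *m S) = qform A w w.
  by rewrite /qform mulmx1 trmx_mul ST mulmxA -(mulmxA w) SA.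
have [->|w0] := eqVneq w 0.
  rewrite mul0mx (_ : enorm 0 = 0) ?mulr0//.
  by rewrite enormE /qform !mul0mx mxE sqrtr0.
have Np : 0 < qform 1%:M w w.
  rewrite lt_neqAle eq_sym; apply/andP; split.
    by apply: contra_neq w0; exact: qform1_eq0.
  by rewrite qform1E; apply: sumr_ge0 => i _; exact: sqr_ge0.
have h := rayleigh_lambda_max w AT.
have l0 : 0 <= lambda_max A.
  have : 0 <= lambda_max A * qform 1%:M w w by apply: le_trans h; rewrite -E qform1_enorm sqr_ge0.
  by rewrite pmulr_lge0.
by rewrite !enormE -sqrtrM// ler_wsqrtr// E.
Qed.

(** * Support of the optimal plan *)

Lemma product_probability_setT d d' (X : measurableType d) (Y : measurableType d')
    (R : realType) (mu : probability X R) (nu : probability Y R) A B :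
  measurable A -> measurable B -> mu A = 1%E -> nu B = 1%E ->
  (mu \x nu)%E (A `*` B) = 1%E.
Proof. by move=> mA mB A1 B1; rewrite product_measure1E// [X in (X * _)%E]A1 [X in (_ * X)%E]B1 mule1. Qed.

Lemma product_full_integral d d' (X : measurableType d) (Y : measurableType d')
    (R : realType) (mu : probability X R) (nu : probability Y R) A B (f : X * Y -> \bar R) :
  measurable A -> measurable B -> mu A = 1%E -> nu B = 1%E ->
  measurable_fun setT f -> (forall z, (0 <= f z)%E) ->
  (\int[mu \x nu]_z f z = \int[mu \x nu]_(z in A `*` B) f z)%E.
Proof.
move=> mA mB A1 B1 mf f0.
have mAB : measurable (A `*` B) by exact: measurableX.
have PT : (mu \x nu)%E setT = 1%E.
  by rewrite -setXTT product_probability_setT//; exact: probability_setT.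
have PAB : (mu \x nu)%E (A `*` B) = 1%E by exact: product_probability_setT.
have P0 : (mu \x nu)%E (~` (A `*` B)) = 0%E.
  rewrite -setTD measureD//; last by rewrite [X in (X < _)%E]PT ltry.
  by rewrite setTI [X in (X - _)%E]PT [X in (_ - X)%E]PAB subee.
rewrite (ge0_negligible_integral _ _ _ _ P0)//; last exact: measurableC.
by rewrite setDE setCK setTI.
Qed.

(* The cost may be changed by functions of one variable, since these integrate
   to the same constant against every coupling. *)
Lemma quadratic_cost_change d d' (X : measurableType d) (Y : measurableType d')
    (R : realType) (mu : probability X R) (nu : probability Y R) (c c' : X * Y -> R)
    (eps : R) (al0 al1 : X -> R) (be0 be1 : Y -> R) (A : set X) (B : set Y)
    (p q : X * Y -> R) :
  measurable A -> measurable B -> mu A = 1%E -> nu B = 1%E -> 0 < eps ->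
  measurable_fun setT c -> measurable_fun setT c' ->
  (forall z, 0 <= c z) -> (forall z, 0 <= c' z) ->
  measurable_fun setT al0 -> measurable_fun setT al1 ->
  measurable_fun setT be0 -> measurable_fun setT be1 ->
  (forall x, 0 <= al0 x) -> (forall x, 0 <= al1 x) ->
  (forall y, 0 <= be0 y) -> (forall y, 0 <= be1 y) ->
  (forall x y, A x -> B y -> c' (x, y) + al0 x + be0 y = c (x, y) + al1 x + be1 y) ->
  (\int[mu]_x (al1 x)%:E < +oo)%E -> (\int[nu]_y (be1 y)%:E < +oo)%E ->
  coupling_density mu nu p -> coupling_density mu nu q ->
  (quadratic_cost mu nu c' eps p <= quadratic_cost mu nu c' eps q)%E ->
  (quadratic_cost mu nu c eps p <= quadratic_cost mu nu c eps q)%E.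
Proof.
move=> mA mB A1 B1 eps0 mc mc' c0 c0' mal0 mal1 mbe0 mbe1 pal0 pal1 pbe0 pbe1 id fal fbe cp cq.
have split_cost (k : X * Y -> R) (al : X -> R) (be : Y -> R) (r : X * Y -> R) :
    measurable_fun setT k -> (forall z, 0 <= k z) ->
    measurable_fun setT al -> (forall z, 0 <= al z) ->
    measurable_fun setT be -> (forall z, 0 <= be z) -> coupling_density mu nu r ->
    (quadratic_cost mu nu k eps r + (\int[mu]_x (al x)%:E + \int[nu]_y (be y)%:E) =
     \int[mu \x nu]_(z in A `*` B) (k z * r z + eps / 2 * r z ^+ 2 +
        (al z.1 * r z + be z.2 * r z))%:E)%E.
  move=> mk k0 mal al0' mbe be0' cr; have [mr r0 _ _] := cr.
  have mal' : measurable_fun setT (fun z : X * Y => al z.1).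
    exact: (measurableT_comp mal measurable_fst).
  have mbe' : measurable_fun setT (fun z : X * Y => be z.2).
    exact: (measurableT_comp mbe measurable_snd).
  have m1 : measurable_fun setT (fun z => k z * r z + eps / 2 * r z ^+ 2).
    apply: measurable_funD; first exact: measurable_funM.
    by apply: measurable_funM => //; exact: measurable_funX.
  have m2 : measurable_fun setT (fun z : X * Y => al z.1 * r z + be z.2 * r z).
    by apply: measurable_funD; exact: measurable_funM.
  have p1 z : 0 <= k z * r z + eps / 2 * r z ^+ 2.
    by rewrite addr_ge0 ?mulr_ge0 ?exprn_ge0//; exact: ltW.
  have p2 z : 0 <= al z.1 * r z + be z.2 * r z by rewrite addr_ge0 ?mulr_ge0.
  rewrite -(@product_full_integral _ _ _ _ _ mu nu A B)//; last 2 first.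
  - by apply/measurable_EFinP; exact: measurable_funD.
  - by move=> z; rewrite lee_fin addr_ge0.
  under [RHS]eq_integral do rewrite EFinD.
  rewrite ge0_integralD//; last 4 first.
  - by move=> z _; rewrite lee_fin.
  - exact/measurable_EFinP.
  - by move=> z _; rewrite lee_fin.
  - exact/measurable_EFinP.
  congr (_ + _)%E; under [RHS]eq_integral do rewrite EFinD.
  rewrite ge0_integralD//; last 4 first.
  - by move=> z _; rewrite lee_fin mulr_ge0.
  - by apply/measurable_EFinP; exact: measurable_funM.
  - by move=> z _; rewrite lee_fin mulr_ge0.
  - by apply/measurable_EFinP; exact: measurable_funM.
  by rewrite (coupling_density_integral_fst cr)// (coupling_density_integral_snd cr).
have key r : coupling_density mu nu r ->
    (quadratic_cost mu nu c' eps r + (\int[mu]_x (al0 x)%:E + \int[nu]_y (be0 y)%:E) =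
     quadratic_cost mu nu c eps r + (\int[mu]_x (al1 x)%:E + \int[nu]_y (be1 y)%:E))%E.
  move=> cr; rewrite !split_cost//; apply: eq_integral => -[x y] /set_mem [/= Ax By].
  congr EFin; have := id x y Ax By; set k' := c' _; set k := c _ => h.
  have -> : k' = k + al1 x + be1 y - al0 x - be0 y by rewrite -h; ring.
  ring.
(* After rewriting with [key], the term to cancel is the integral of [al1] and [be1], whose
   finiteness is assumed. *)
move=> le; have := leeD2r (\int[mu]_x (al0 x)%:E + \int[nu]_y (be0 y)%:E)%E le.
rewrite !key// leeD2rE// fin_numD ?ge0_fin_numE ?fal//; apply: integral_ge0 => *; by rewrite lee_fin.
Qed.

(** At far pairs the slack of any sufficiently good approximate potential vanishes, so weak duality
    bounds the integral of [f ^ 2] there by an error of order [s]. Since [f] does not depend on [s],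
    that integral is 0. *)
Lemma optimal_density_near_diagonal d d' (X : measurableType d) (Y : measurableType d')
    (R : realType) (mu : probability X R) (nu : probability Y R) (U : Y -> X)
    (e : X * X -> R) (Om : set X) (K eps dlt m : R) (f : X * Y -> R) :
  measurable_fun setT U -> (forall E, measurable E -> mu E = nu (U @^-1` E)) ->
  measurable Om -> mu Om = 1%E ->
  measurable_fun setT e -> (forall z, 0 <= e z <= K) -> 0 <= K ->
  (forall x y, e (x, y) = e (y, x)) ->
  (forall x x' y (L : R), Om x -> Om x' -> Om y -> 0 <= L -> e (x, x') <= dlt ^+ 2 / 2 ->
     e (x', y) <= L ^+ 2 / 2 -> e (x, y) <= e (x', y) + dlt ^+ 2 / 2 + dlt * L) ->
  (forall x, Om x -> (m%:E <= mu (Om `&` [set y | (e (x, y) <= dlt ^+ 2 / 2)%R]))%E) ->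
  0 < m -> 0 < dlt -> m * dlt ^+ 2 = eps ->
  coupling_density mu nu f ->
  (forall g, coupling_density mu nu g ->
    (quadratic_cost mu nu (fun z => e (z.1, U z.2)) eps f <=
     quadratic_cost mu nu (fun z => e (z.1, U z.2)) eps g)%E) ->
  (\int[mu \x nu]_(z in [set z | [/\ Om z.1, Om (U z.2) &
     ((8 * dlt) ^+ 2 / 2 < e (z.1, U z.2))%R]]) (f z)%:E = 0)%E.
Proof.
move=> mU muU mOm Om1 me eK K0 esym elip mball m0 dlt0 mdlt cf fopt.
set D := [set z | _].
have eps0 : 0 < eps by rewrite -mdlt mulr_gt0// exprn_gt0.
have [mf f0 _ _] := cf.
pose c (z : X * Y) := e (z.1, U z.2).
have mU2 : measurable_fun setT (fun z : X * Y => U z.2).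
  exact: (measurableT_comp mU measurable_snd).
have mc : measurable_fun setT c.
  by apply: (measurableT_comp me); exact: measurable_fun_pair.
have mD : measurable D.
  have -> : D = ((fst @^-1` Om) `&` ((fun z : X * Y => U z.2) @^-1` Om)) `&`
      [set z | (8 * dlt) ^+ 2 / 2 < c z].
    by apply/seteqP; split => z /= => [[? ? ?]|[[? ?] ?]].
  apply: measurableI; first apply: measurableI.
  - by rewrite -[X in measurable X]setTI; exact: measurable_fst.
  - by rewrite -[X in measurable X]setTI; exact: mU2.
  - have -> : [set z | (8 * dlt) ^+ 2 / 2 < c z] = ~` [set z | c z <= (8 * dlt) ^+ 2 / 2].
      by apply/seteqP; split => z /=; rewrite ltNge => /negP.
    apply: measurableC.
    have := @measurable_fun_le _ _ _ setT c (fun=> (8 * dlt) ^+ 2 / 2) measurableT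
      mc (@measurable_cst _ _ _ _ _ _).
    by rewrite setTI.
pose N := 2 * K + 2 * eps; have N0 : 0 < N by rewrite /N; lra.
pose C := 2 * (2 * N / eps) + 9.
have C0 : 0 < C.
  rewrite /C; have : 0 <= 2 * N / eps by rewrite divr_ge0 ?mulr_ge0// ltW.
  lra.
pose J := (\int[mu \x nu]_z (eps / 2 * f z ^+ 2 * \1_D z)%:E)%E.
have J0 : (0 <= J)%E.
  by apply: integral_ge0 => z _; rewrite lee_fin !mulr_ge0 ?exprn_ge0//; exact: ltW.
have Js s : 0 < s <= 1 / 2 ->
    (J <= (eps / 2 * (C * s) ^+ 2 + (2 * N + K) * (C * s))%:E)%E.
  move=> /andP[s0 s1].
  have [k k0 kE] : exists2 k : R, 0 < k & k = dlt ^+ 2 / (8 * N).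
    by exists (dlt ^+ 2 / (8 * N)); rewrite // divr_gt0 ?exprn_gt0 ?mulr_gt0.
  pose t := k * eps / (2 * (2 + k)).
  have t0 : 0 < t by rewrite divr_gt0 ?mulr_gt0//; lra.
  (* The three terms serve the marginal error for weak duality, the margin in the localization, and
     the strict inequality [eta4], which amounts to [(2 + k) * eta < k * eps]. *)
  pose eta := Num.min (s * eps) (Num.min (eps / 8) t).
  have eta0 : 0 < eta by rewrite !lt_min mulr_gt0// t0 divr_gt0.
  have eta1 : eta <= s * eps by rewrite ge_min lexx.
  have eta2 : eta <= eps / 8 by rewrite !ge_min lexx orbT.
  have eta3 : eta <= t by rewrite !ge_min lexx !orbT.
  have eta4 : eps + eta < (1 + k) * (eps - eta).
    have : eta * (2 + k) <= t * (2 + k) by rewrite ler_wpM2r//; lra.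
    have k2 : 2 + k != 0 by rewrite gt_eqF// addr_gt0.
    have -> : t * (2 + k) = k * eps / 2 by rewrite /t; field.
    have : 0 < k * eps by rewrite mulr_gt0.
    lra.
  rewrite kE in eta4.
  have [phi [mphi phiN row]] := approximate_potential mu me eK K0 eps0 eta0.
  have near := slack_near_diagonal mOm Om1 me eK esym elip mball m0 dlt0 mdlt N0 eta0
    eta2 eta4 mphi phiN row.
  have mpsi : measurable_fun setT (phi \o U) by exact: (measurableT_comp mphi mU).
  apply: (@optimal_density_bound _ _ _ _ _ mu nu c f phi (phi \o U) K N eps s C D) => //.
  - by move=> z; exact: eK.
  - exact: ltW.
  - by move=> y; exact: phiN.
  - by rewrite s0 s1.
  - move=> x; apply: le_trans eta1; suff -> : \int[nu]_y slack phi (phi \o U) c (x, y) =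
        rowint mu e phi x by exact: row.
    rewrite /rowint /Rintegral; congr fine.
    rewrite (@integral_map _ _ Y X R nu mu U (fun y => (slack phi phi e (x, y))%:E))//.
    + by apply/measurable_EFinP; exact: measurable_slack_row.
    + by move=> y; rewrite lee_fin slack_ge0.
  - move=> y; apply: le_trans eta1; suff -> : \int[mu]_x slack phi (phi \o U) c (x, y) =
        rowint mu e phi (U y) by exact: row.
    rewrite /rowint; congr (Rintegral _ _ _); apply/funext => x.
    by rewrite /slack /c /= esym (addrC (phi x)).
  - move=> z [Oz1 Oz2 far].
    case: (slackP phi (phi \o U) c z) => -[-> h//].
    by have := near _ _ Oz1 Oz2 h; rewrite leNgt far.
have Jfin : J \is a fin_num.
  rewrite ge0_fin_numE//; apply: (le_lt_trans (Js (1 / 2) _)); last exact: ltry.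
  by apply/andP; split; lra.
have J00 : J = 0%E.
  apply/eqP; rewrite eq_le J0 andbT -(fineK Jfin) lee_fin.
  apply: (@le_limit0 _ _ _ (eps / 2 * C ^+ 2 + (2 * N + K) * C)) => t /andP[t0 t1].
  rewrite -lee_fin fineK//.
  have tt : 0 < t / 2 <= 1 / 2 by apply/andP; split; lra.
  apply: le_trans (Js _ tt) _; rewrite lee_fin add0r.
  have h1 : 0 <= eps * C ^+ 2 * t by rewrite !mulr_ge0 ?exprn_ge0// ltW.
  have h2 : t ^+ 2 <= t by rewrite expr2 ler_piMl// ltW.
  have NK : 0 <= 2 * N + K by rewrite addr_ge0// mulr_ge0// ltW.
  have h3 : 0 <= (2 * N + K) * C * t.
    by apply: mulr_ge0; [apply: mulr_ge0 => // | ]; exact: ltW.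
  have h4 : eps * C ^+ 2 * t ^+ 2 <= eps * C ^+ 2 * t.
    by apply: ler_wpM2l => //; rewrite mulr_ge0 ?exprn_ge0// ltW.
  rewrite (_ : (C * (t / 2)) ^+ 2 = C ^+ 2 * t ^+ 2 / 4); last by field.
  lra.
have P1 : (mu \x nu)%E setT = 1%E.
  by rewrite -setXTT product_probability_setT//; exact: probability_setT.
apply/eqP; rewrite eq_le; apply/andP; split; last first.
  by apply: integral_ge0 => z _; rewrite lee_fin.
apply/lee_addgt0Pr => t t0; rewrite add0e.
have tn : t != 0 by rewrite gt_eqF.
have epsn : eps != 0 by rewrite gt_eqF.
(* Chosen so that [k * (eps / 2 * f ^ 2)] is [f ^ 2 / (4 * t)]. Then [f <= f ^ 2 / (4 * t) + t] by a
   square, and as [J = 0] the integral of [f] over [D] is at most [t]. *)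
pose k := (2 * eps * t)^-1.
have k0 : 0 <= k by rewrite invr_ge0 !mulr_ge0// ltW.
have msq : measurable_fun setT (fun z => eps / 2 * f z ^+ 2 * \1_D z).
  apply: measurable_funM => //.
  by apply: measurable_funM => //; exact: measurable_funX.
have sq0 z : 0 <= eps / 2 * f z ^+ 2 * \1_D z.
  by rewrite !mulr_ge0 ?exprn_ge0//; exact: ltW.
have -> : (t%:E = \int[mu \x nu]_z ((k * (eps / 2 * f z ^+ 2 * \1_D z))%:E + t%:E))%E.
  rewrite ge0_integralD//; last 3 first.
  - by move=> z _; rewrite lee_fin mulr_ge0.
  - by apply/measurable_EFinP; exact: measurable_funM.
  - by move=> z _; rewrite lee_fin ltW.
  under eq_integral do rewrite EFinM.
  rewrite ge0_integralZl//; last 2 first.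
  - exact/measurable_EFinP.
  - by move=> z _; rewrite lee_fin.
  by rewrite -/J J00 mule0 add0e integral_cst// [X in (_ * X)%E]P1 mule1.
rewrite integral_mkcond; apply: ge0_le_integral => //.
- by move=> z _; apply: erestrict_ge0 => w _; rewrite lee_fin.
- apply/measurable_restrict => //.
  by apply: measurable_funTS; exact/measurable_EFinP.
- apply/measurable_EFinP; apply: measurable_funD => //; exact: measurable_funM.
- move=> z _; rewrite -EFinD patchE; case: ifPn => zD; last first.
    by rewrite lee_fin addr_ge0 ?mulr_ge0//; exact: ltW.
  rewrite lee_fin indicE zD mulr1.
  have -> : k * (eps / 2 * f z ^+ 2) = f z ^+ 2 / (4 * t) by rewrite /k; field; rewrite ?tn ?epsn.
  rewrite -subr_ge0; have -> : f z ^+ 2 / (4 * t) + t - f z = (f z - 2 * t) ^+ 2 / (4 * t).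
    by field; rewrite ?tn.
  by rewrite divr_ge0 ?sqr_ge0// mulr_ge0// ltW.
Qed.

(** * Euclidean norm and measurability *)

Lemma enorm_ge0 (R : realType) (m : nat) (x : 'rV[R]_m) : 0 <= enorm x.
Proof. exact: sqrtr_ge0. Qed.

Lemma enormN (R : realType) (m : nat) (x : 'rV[R]_m) : enorm (- x) = enorm x.
Proof. by rewrite /enorm; congr Num.sqrt; apply: eq_bigr => i _; rewrite mxE sqrrN. Qed.

Lemma enormB (R : realType) (m : nat) (x y : 'rV[R]_m) : enorm (x - y) = enorm (y - x).
Proof. by rewrite -enormN opprB. Qed.

Lemma enorm_sqrD (R : realType) (m : nat) (v w : 'rV[R]_m) :
  enorm (v + w) ^+ 2 = enorm v ^+ 2 + 2 * qform 1%:M v w + enorm w ^+ 2.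
Proof.
rewrite -!qform1_enorm; have := @qform_sqrD R m 1%:M 1 v w (trmx1 _ _).
by rewrite scale1r expr1n mul1r mulr1.
Qed.

Lemma qform1_le (R : realType) (m : nat) (v w : 'rV[R]_m) (a b : R) :
  0 <= a -> 0 <= b -> enorm v <= a -> enorm w <= b -> qform 1%:M v w <= a * b.
Proof.
move=> a0 b0 va wb; apply: le_trans (ler_norm _) _.
rewrite -(@ler_pXn2r _ 2) ?nnegrE ?mulr_ge0// real_normK ?num_real// exprMn.
apply: (le_trans (qform_cauchy_schwarz v w (trmx1 _ _) _)).
  by move=> u; rewrite qform1_enorm sqr_ge0.
rewrite !qform1_enorm; apply: ler_pM; rewrite ?sqr_ge0//;
  by rewrite ler_pXn2r ?nnegrE ?enorm_ge0.
Qed.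

Lemma enorm_triangle (R : realType) (m : nat) (v w : 'rV[R]_m) :
  enorm (v + w) <= enorm v + enorm w.
Proof.
rewrite -(@ler_pXn2r _ 2) ?nnegrE ?addr_ge0 ?enorm_ge0// enorm_sqrD.
have := qform1_le (enorm_ge0 v) (enorm_ge0 w) (lexx _) (lexx _).
by rewrite sqrrD -mulr_natl; lra.
Qed.

Lemma coord_le_enorm (R : realType) (m : nat) (x : 'rV[R]_m) i : `|x 0 i| <= enorm x.
Proof.
rewrite -(@ler_pXn2r _ 2) ?nnegrE ?enorm_ge0// real_normK ?num_real//.
by rewrite -qform1_enorm qform1E (bigD1 i)//= lerDl; apply: sumr_ge0 => k _; exact: sqr_ge0.
Qed.

Lemma measurable_enorm_sqr d (T : measurableType d) (R : realType) (n : nat) (f : T -> Rd R n) :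
  measurable_fun setT f -> measurable_fun setT (fun t => enorm (f t) ^+ 2).
Proof.
move=> mf.
have -> : (fun t => enorm (f t) ^+ 2) = (fun t => \sum_i f t 0 i ^+ 2).
  by apply/funext => t; rewrite -qform1_enorm qform1E.
apply: measurable_sum => i; apply: measurable_funX.
exact: (measurableT_comp (@measurable_coord R n i) mf).
Qed.

Lemma measurable_subr d (T : measurableType d) (R : realType) (n : nat) (f g : T -> Rd R n) :
  measurable_fun setT f -> measurable_fun setT g ->
  measurable_fun setT (fun t => f t - g t : Rd R n).
Proof.
move=> mf mg; apply: measurable_fun_row => i.
have -> : (fun t => (f t - g t) 0 i) = (fun t => f t 0 i - g t 0 i).
  by apply/funext => t; rewrite !mxE.
apply: measurable_funB.
- exact: (measurableT_comp (@measurable_coord R n i) mf).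
- exact: (measurableT_comp (@measurable_coord R n i) mg).
Qed.

Lemma measurable_sublevel d (T : measurableType d) (R : realType) (f : T -> R) (r : R) :
  measurable_fun setT f -> measurable [set t | f t <= r].
Proof.
move=> mf; have := @measurable_fun_le _ _ _ setT f (fun=> r) measurableT mf
  (@measurable_cst _ _ _ _ _ _).
by rewrite setTI.
Qed.

Lemma measurable_eball (R : realType) (n : nat) (u : 'rV[R]_n.+1) (r : R) :
  0 <= r -> measurable (eball u r : set (Rd R n)).
Proof.
move=> r0; have -> : eball u r = [set x : Rd R n | enorm (x - u : Rd R n) ^+ 2 <= r ^+ 2].
  by apply/seteqP; split => x; rewrite /eball /= ler_pXn2r ?nnegrE ?enorm_ge0.
apply: measurable_sublevel; apply: measurable_enorm_sqr; exact: measurable_translation.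
Qed.

(** * Reduction of the affine problem to self-transport *)

Lemma sym_posdef_unitmx (R : realType) (m : nat) (S : 'M[R]_m) :
  sym_posdef S -> S \in unitmx.
Proof.
move=> [_ pd]; rewrite -row_free_unit -kermx_eq0; apply/rowV0P => v /sub_kermxP vS.
apply/eqP; apply: contraT => v0; have := pd v v0.
by rewrite vS mul0mx mxE ltxx.
Qed.

(** On a null set [rho] may fall below [lamlo] and even be negative, so it is first replaced by its
    maximum with [lamlo]. *)
Lemma density_lower_bound (R : realType) (n : nat) (leb : {measure set (Rd R n) -> \bar R})
    (mu : probability (Rd R n) R) (Omega : set 'rV[R]_n.+1) (rho : Rd R n -> R)
    (lamlo lamhi : R) (E : set (Rd R n)) :
  open Omega -> measurable_fun (Omega : set (Rd R n)) rho ->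
  (forall E : set (Rd R n), measurable E ->
     mu E = (\int[leb]_(x in E `&` Omega) (rho x)%:E)%E) ->
  0 < lamlo ->
  {ae leb, forall x : Rd R n, Omega x -> lamlo <= rho x <= lamhi} ->
  measurable E -> (lamlo%:E * leb (E `&` Omega) <= mu E)%E.
Proof.
move=> oO mrho Hmu lam0 bd mE.
have mO : measurable (Omega : set (Rd R n)) by exact: measurable_open.
have mEO : measurable (E `&` Omega) by exact: measurableI.
have mr : measurable_fun (E `&` Omega) rho.
  by apply: measurable_funS mrho => // x [].
rewrite Hmu// (@ae_eq_integral _ _ _ leb (E `&` Omega) (fun x => (Num.max (rho x) lamlo)%:E))//.
- rewrite -integral_cst//; apply: ge0_le_integral => //.
  + by move=> x _; rewrite lee_fin ltW.
  + by apply/measurable_EFinP; exact: measurable_maxr.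
  + by move=> x _; rewrite lee_fin le_max lexx orbT.
- by apply/measurable_EFinP.
- by apply/measurable_EFinP; exact: measurable_maxr.
- apply: filterS bd => x h [_ /h /andP[h1 _]].
  by rewrite max_l.
Qed.

Lemma reg_objectiveE (R : realType) (n : nat) (mu nu : probability (Rd R n) R) (eps : R)
    (pi : {measure set (Rd R n * Rd R n) -> \bar R}) (f : Rd R n * Rd R n -> R) :
  0 < eps -> has_density (mu \x nu)%E pi f ->
  reg_objective eps (mu \x nu)%E pi f = quadratic_cost mu nu cost eps f.
Proof.
move=> eps0 [mf [f0 fE]].
have c0 z : 0 <= cost z :> R by rewrite divr_ge0 ?sqr_ge0.
have mc : measurable_fun setT (@cost R n).
  apply: measurable_funM => //; apply: measurable_enorm_sqr.
  by apply: measurable_subr; [exact: measurable_fst|exact: measurable_snd].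
rewrite /reg_objective (integral_density mf f0 fE); last 2 first.
- exact/measurable_EFinP.
- by move=> z; rewrite lee_fin.
have msq : measurable_fun setT (fun z => f z ^+ 2) by exact: measurable_funX.
rewrite -ge0_integralZl//; last 3 first.
- exact/measurable_EFinP.
- by move=> z _; rewrite lee_fin sqr_ge0.
- by rewrite lee_fin divr_ge0// ltW.
rewrite /quadratic_cost -ge0_integralD//.
- by move=> z _; rewrite mule_ge0 ?lee_fin.
- by apply: emeasurable_funM; exact/measurable_EFinP.
- by move=> z _; rewrite -EFinM lee_fin mulr_ge0 ?sqr_ge0// divr_ge0// ltW.
- by apply: emeasurable_funM => //; exact/measurable_EFinP.
Qed.

Lemma reg_ot_plan_optimal (R : realType) (n : nat) (mu nu : probability (Rd R n) R)
    (eps : R) (pi : {measure set (Rd R n * Rd R n) -> \bar R}) :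
  0 < eps -> is_reg_ot_plan mu nu eps pi ->
  exists f, [/\ coupling_density mu nu f,
    forall E, measurable E -> pi E = (\int[mu \x nu]_(z in E) (f z)%:E)%E &
    forall g, coupling_density mu nu g ->
      (quadratic_cost mu nu cost eps f <= quadratic_cost mu nu cost eps g)%E].
Proof.
move=> eps0 [cpi [f [df fopt]]]; have [mf [f0 fE]] := df.
exists f; split => //.
  split => // A mA; rewrite -fE; last exact: measurableX.
    by case: (cpi A mA).
  exact: measurableX.
  by case: (cpi A mA).
move=> g [mg g0 gA gB].
have [rho rhoE] := density_measure_exists (mu \x nu)%E mg g0.
have dg : has_density (mu \x nu)%E rho g by split.
rewrite -(reg_objectiveE eps0 df) -(reg_objectiveE eps0 dg); apply: fopt => // A mA.
by split; rewrite rhoE; [exact: gA|exact: measurableX|exact: gB|exact: measurableX].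
Qed.

(** With y = uA + a the product of x and y is that of xS and uS plus that of x and a. The last term
    has no sign; it is absorbed by the square of [x + a], so that all functions of one variable are
    nonnegative. *)
Lemma affine_cost_identity (R : realType) (n : nat) (A S : 'M[R]_n.+1) (a x u : 'rV[R]_n.+1) :
  S^T = S -> S *m S = A ->
  enorm (x - (u *m A + a)) ^+ 2 / 2 + (enorm (x *m S) ^+ 2 / 2 + enorm (x + a) ^+ 2 / 2)
    + enorm (u *m S) ^+ 2 / 2 =
  enorm ((x - u) *m S) ^+ 2 / 2 + enorm x ^+ 2
    + (enorm (u *m A + a) ^+ 2 / 2 + enorm a ^+ 2 / 2).
Proof.
move=> ST SA.
have I1 := trmx1 R n.+1.
have h1 : qform 1%:M x (u *m A + a) = qform 1%:M (x *m S) (u *m S) + qform 1%:M x a.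
  rewrite (qform_sym _ _ I1) qformDl (qform_sym _ _ I1); congr (_ + _).
    by rewrite /qform !mulmx1 -SA !trmx_mul ST !mulmxA.
  by rewrite (qform_sym _ _ I1).
have h2 (v w : 'rV[R]_n.+1) : qform 1%:M v (- w) = - qform 1%:M v w.
  by rewrite (qform_sym _ _ I1) -scaleN1r qformZl mulN1r (qform_sym _ _ I1).
rewrite mulmxBl !enorm_sqrD !enormN !h2 h1 enorm_sqrD.
by field.
Qed.

Lemma lebesgue_hbox_pos (R : realType) (n : nat) (leb : {measure set (Rd R n) -> \bar R})
    (x : 'rV[R]_n.+1) (t : R) : is_lebesgue leb -> 0 < t ->
  (0 < leb (hbox (x - const_mx t) (x + const_mx t)))%E.
Proof.
move=> Hleb t0; rewrite lebesgue_hbox// lte_fin; apply: prodr_gt0 => i _.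
by rewrite lt_max !mxE; apply/orP; left; lra.
Qed.

Lemma enorm_mulmx_bound (R : realType) (n : nat) (S : 'M[R]_n.+1) :
  S^T = S -> exists2 C : R, 0 < C & forall v, enorm (v *m S) ^+ 2 <= C * enorm v ^+ 2.
Proof.
move=> ST; have [C C0 hC] := qform_bound (S *m S); exists C => // v.
rewrite -!qform1_enorm; have -> : qform 1%:M (v *m S) (v *m S) = qform (S *m S) v v.
  by rewrite /qform mulmx1 trmx_mul ST !mulmxA.
exact: hC.
Qed.

Lemma image_mulmxE (R : realType) (n : nat) (S : 'M[R]_n.+1) (Omega : set 'rV[R]_n.+1) x :
  S \in unitmx -> [set x *m S | x in Omega] (x *m S) <-> Omega x.
Proof.
move=> uS; split => [[y Oy yx]|Ox]; last by exists x.
by rewrite -(mulmxK uS x) -yx mulmxK.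
Qed.

(** The infimum [kappaA] ranges over centres in the support; this makes it applicable at the images
    of all points of [Omega]. *)
Lemma spt_pushforward (R : realType) (n : nat) (leb : {measure set (Rd R n) -> \bar R})
    (mu : probability (Rd R n) R) (Omega : set 'rV[R]_n.+1) (lamlo : R)
    (S : 'M[R]_n.+1) x :
  is_lebesgue leb -> open Omega -> 0 < lamlo -> S^T = S ->
  (forall E : set (Rd R n), measurable E -> (lamlo%:E * leb (E `&` Omega) <= mu E)%E) ->
  Omega x -> spt (push mu (fun x : Rd R n => x *m S : Rd R n)) (x *m S).
Proof.
move=> Hleb oO lam0 ST lb Ox r r0; rewrite /push.
have mO : measurable (Omega : set (Rd R n)) by exact: measurable_open.
have mpre : measurable ((fun x : Rd R n => x *m S : Rd R n) @^-1` eball (x *m S) r).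
  rewrite -[X in measurable X]setTI; apply: measurable_mulmx => //.
  by apply: measurable_eball; exact: ltW.
apply: lt_le_trans (lb _ mpre).
apply: mule_gt0; first by rewrite lte_fin.
have [e e0 eO] := open_rowP oO Ox.
have [C C0 hC] := enorm_mulmx_bound ST.
(* On the box of half-width [t] the squared norm of [(y - x) *m S] is at most [C * n.+1 * t ^ 2],
   hence at most [(t * D) ^ 2]. *)
pose D := 1 + C * n.+1%:R.
have D1 : 1 <= D by rewrite /D lerDl mulr_ge0// ltW.
pose t := Num.min (e / 2) (r / D).
have t0 : 0 < t by rewrite lt_min !divr_gt0//; lra.
have te : t <= e / 2 by rewrite ge_min lexx.
have tr : t * D <= r by rewrite -ler_pdivlMr ?ge_min ?lexx ?orbT//; lra.
apply: lt_le_trans (lebesgue_hbox_pos x Hleb t0) _.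
apply: le_measure; rewrite ?inE; [exact: measurable_hbox|exact: measurableI|].
move=> y hy.
have yx j : `|x 0 j - y 0 j| <= t.
  by have := hy j; rewrite !mxE ler_norml => /andP[? ?]; apply/andP; split; lra.
split; last by apply: eO => j; apply: le_lt_trans (yx j) _; lra.
rewrite /= /eball /= -mulmxBl -(@ler_pXn2r _ 2) ?nnegrE ?enorm_ge0//; last exact: ltW.
apply: le_trans (hC _) _.
have h : enorm (y - x) ^+ 2 <= n.+1%:R * t ^+ 2.
  rewrite -qform1_enorm qform1E.
  apply: (@le_trans _ _ (\sum_(i < n.+1) t ^+ 2)); last first.
    by rewrite sumr_const card_ord mulr_natl.
  apply: ler_sum => i _; rewrite !mxE -real_normK ?num_real// distrC.
  by rewrite ler_pXn2r ?nnegrE// ltW.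
apply: (@le_trans _ _ (C * (n.+1%:R * t ^+ 2))); first by rewrite ler_pM2l.
apply: (@le_trans _ _ ((t * D) ^+ 2)); last first.
  by rewrite ler_pXn2r ?nnegrE ?mulr_ge0//; lra.
rewrite mulrA mulrC exprMn ler_pM2l ?exprn_gt0//.
apply: (@le_trans _ _ D); first by rewrite /D lerDr.
by rewrite expr2 ler_peMl//; lra.
Qed.

Lemma pushforward_ball_mass (R : realType) (n : nat)
    (leb : {measure set (Rd R n) -> \bar R}) (mu : probability (Rd R n) R)
    (Omega : set 'rV[R]_n.+1) (lamlo : R) (S : 'M[R]_n.+1) (x : 'rV[R]_n.+1) (r k : R) :
  is_lebesgue leb -> open Omega -> 0 <= lamlo -> S \in unitmx -> 0 <= r ->
  (forall E : set (Rd R n), measurable E -> (lamlo%:E * leb (E `&` Omega) <= mu E)%E) ->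
  k <= fine (leb ([set x *m S | x in Omega] `&` eball (x *m S) r)) ->
  ((lamlo / `|\det S| * k)%:E <=
     mu ((Omega : set (Rd R n)) `&` [set y : Rd R n | (enorm ((x - y) *m S) <= r)%R]))%E.
Proof.
move=> Hleb oO lam0 uS r0 lb hk.
have mO : measurable (Omega : set (Rd R n)) by exact: measurable_open.
have mS := @measurable_mulmx R n S; have mSi := @measurable_mulmx R n (invmx S).
have mOS : measurable ([set x *m S | x in Omega] : set (Rd R n)).
  have -> : [set x *m S | x in Omega] =
      (fun x : Rd R n => x *m invmx S : Rd R n) @^-1` (Omega : set (Rd R n)).
    apply/seteqP; split => y /=; first by move=> [z Oz <-]; rewrite mulmxK.
    by move=> h; exists (y *m invmx S) => //; rewrite mulmxKV.
  by rewrite -[X in measurable X]setTI; exact: mSi.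
have mB := @measurable_eball R n (x *m S) r r0.
set E := _ `&` _ in hk.
have mE : measurable (E : set (Rd R n)) by exact: measurableI.
have Efin : leb E \is a fin_num.
  rewrite ge0_fin_numE; last exact: measure_ge0.
  pose lo : 'rV[R]_n.+1 := x *m S - const_mx r; pose hi : 'rV[R]_n.+1 := x *m S + const_mx r.
  apply: (@le_lt_trans _ _ (leb [set y : Rd R n | forall i, lo 0 i <= y 0 i <= hi 0 i])).
    apply: le_measure; rewrite ?inE//; first exact: measurable_cbox.
    move=> y [_ hy] i; have := le_trans (coord_le_enorm (y - x *m S) i) hy.
    have subE (v w : 'rV[R]_n.+1) : (v - w) 0 i = v 0 i - w 0 i by rewrite !mxE.
    have addE (v w : 'rV[R]_n.+1) : (v + w) 0 i = v 0 i + w 0 i by rewrite !mxE.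
    have rE : (const_mx r : 'rV[R]_n.+1) 0 i = r by rewrite mxE.
    rewrite /lo /hi !subE addE rE ler_norml => /andP[? ?].
    by apply/andP; split; lra.
  by rewrite Hleb ltry.
pose F := [set y : Rd R n | (enorm ((x - y) *m S) <= r)%R].
have mF : measurable F.
  have -> : F = (fun y : Rd R n => y *m S : Rd R n) @^-1` (eball (x *m S) r).
    by apply/seteqP; split => y; rewrite /F /eball /= mulmxBl enormB.
  by rewrite -[X in measurable X]setTI; exact: mS.
have EF : [set y : Rd R n | E (y *m S)] = (Omega : set (Rd R n)) `&` F.
  apply/seteqP; split => y; rewrite /E /F /eball /= mulmxBl enormB.
    by move=> [/(image_mulmxE _ _ uS) ? ?].
  by move=> [? ?]; split => //; apply/(image_mulmxE _ _ uS).
have := lb _ (measurableI _ _ mO mF).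
rewrite setIAC setIid; apply: le_trans.
have := lebesgue_mulmx_ge Hleb uS mE; rewrite EF => h.
apply: (@le_trans _ _ (lamlo%:E * ((`|\det S|^-1)%:E * leb E))%E); last first.
  by apply: lee_wpmul2l; rewrite ?lee_fin.
by rewrite -(fineK Efin) -!EFinM lee_fin -mulrA ler_wpM2l// ler_wpM2l// invr_ge0.
Qed.

Lemma half_sqr_le (R : realType) (s p q : R) :
  0 <= s -> s <= p + q -> s ^+ 2 / 2 <= p ^+ 2 + q ^+ 2.
Proof.
move=> s0 spq; have pq0 : 0 <= p + q by exact: le_trans spq.
have h : s ^+ 2 <= (p + q) ^+ 2 by rewrite ler_pXn2r.
have := sqr_ge0 (p - q); rewrite !expr2 in h *; lra.
Qed.

Lemma powR_root (R : realType) (x : R) (k : nat) :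
  (0 < k)%N -> 0 <= x -> powR x (1 / k%:R) ^+ k = x.
Proof.
move=> k0 x0; rewrite -powR_mulrn ?powR_ge0// -powRrM div1r mulVf ?powRr1//.
by rewrite pnatr_eq0 -lt0n.
Qed.

(** With [U] the inverse of the affine map, [y - (x *m A + a)] equals [- ((x - U y) *m S *m S)]. One
    factor [S] belongs to the self-transport distance, bounded by [8 * dlt]; the other contributes
    the square root of [lambda_max A]. *)
Lemma affine_plan_support (R : realType) (n : nat) (mu nu : probability (Rd R n) R)
    (Omega : set 'rV[R]_n.+1) (A S : 'M[R]_n.+1) (a : 'rV[R]_n.+1) (eps dlt m : R)
    (piE : {measure set (Rd R n * Rd R n) -> \bar R}) :
  open Omega -> Omega `<=` eball 0 1 -> mu (Omega : set (Rd R n)) = 1%E ->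
  sym_posdef A -> sym_posdef S -> S *m S = A ->
  (forall E : set (Rd R n), measurable E ->
     nu E = mu ((fun x : Rd R n => x *m A + a : Rd R n) @^-1` E)) ->
  0 < m -> 0 < dlt -> m * dlt ^+ 2 = eps ->
  (forall x, Omega x -> (m%:E <=
     mu ((Omega : set (Rd R n)) `&` [set y : Rd R n | (enorm ((x - y) *m S) <= dlt)%R]))%E) ->
  is_reg_ot_plan mu nu eps piE ->
  forall x y, spt2 piE (x, y) ->
    enorm (y - (x *m A + a)) <= 8 * Num.sqrt (lambda_max A) * dlt.
Proof.
move=> oO Ob O1 pdA pdS SA nuE m0 dlt0 mdlt mball plan x0 y0 sxy.
have [AT _] := pdA; have [ST _] := pdS.
have uA := sym_posdef_unitmx pdA.
have eps0 : 0 < eps by rewrite -mdlt mulr_gt0// exprn_gt0.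
have mO : measurable (Omega : set (Rd R n)) by exact: measurable_open.
have [f [cf fE fopt]] := reg_ot_plan_optimal eps0 plan.
pose U (y : Rd R n) : Rd R n := (y - a) *m invmx A.
have mU : measurable_fun setT U.
  apply: (measurableT_comp (@measurable_mulmx R n (invmx A))).
  exact: measurable_translation.
have TU y : U y *m A + a = y by rewrite /U mulmxKV// subrK.
have UT x : U (x *m A + a) = x by rewrite /U addrK mulmxK.
have muU E : measurable E -> mu E = nu (U @^-1` E).
  move=> mE; rewrite nuE; last by rewrite -[X in measurable X]setTI; exact: mU.
  by congr (mu _); apply/seteqP; split => x /=; rewrite UT.
have [C C0 hC] := enorm_mulmx_bound ST.
pose K := 2 * C; have K0 : 0 <= K by rewrite mulr_ge0// ltW.
have Onorm x : Omega x -> enorm x <= 1 by move=> /Ob; rewrite /eball /= subr0.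
pose e0 (x y : Rd R n) : R := enorm ((x - y) *m S) ^+ 2 / 2.
have e0K x y : Omega x -> Omega y -> e0 x y <= K.
  move=> /Onorm Ox /Onorm Oy; rewrite /e0 ler_pdivrMr//; apply: le_trans (hC _) _.
  rewrite /K mulrAC (mulrC _ C) ler_pM2l//.
  have h : enorm (x - y) <= 2.
    by apply: le_trans (enorm_triangle _ _) _; rewrite enormN; lra.
  have := enorm_ge0 (x - y); nra.
(* Truncation makes the cost bounded everywhere and changes nothing on [Omega], where distances are
   at most 2 and thus [e0 <= 2 * C]. *)
pose e (z : Rd R n * Rd R n) : R := Num.min (e0 z.1 z.2) K.
have eE x y : Omega x -> Omega y -> e (x, y) = e0 x y.
  by move=> Ox Oy; rewrite /e /= min_l// e0K.
have e00 x y : 0 <= e0 x y by rewrite divr_ge0 ?sqr_ge0.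
have eK z : 0 <= e z <= K by rewrite le_min e00 K0 ge_min lexx orbT.
have me : measurable_fun setT e.
  apply: measurable_minr => //; apply: measurable_funM => //.
  apply: measurable_enorm_sqr; apply: (measurableT_comp (@measurable_mulmx R n S)).
  by apply: measurable_subr; [exact: measurable_fst|exact: measurable_snd].
have esym x y : e (x, y) = e (y, x).
  by rewrite /e /e0 /= -(enormN ((x - y) *m S)) -mulNmx opprB.
have sqle (r s : R) : 0 <= r -> 0 <= s -> r ^+ 2 / 2 <= s ^+ 2 / 2 -> r <= s.
  by move=> r0 s0; rewrite ler_pM2r// ler_pXn2r.
have elip x x' y (L : R) : Omega x -> Omega x' -> Omega y -> 0 <= L ->
    e (x, x') <= dlt ^+ 2 / 2 -> e (x', y) <= L ^+ 2 / 2 ->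
    e (x, y) <= e (x', y) + dlt ^+ 2 / 2 + dlt * L.
  move=> Ox Ox' Oy L0; rewrite !eE// /e0 => h1 h2.
  have -> : (x - y) *m S = (x - x') *m S + (x' - y) *m S.
    by rewrite -mulmxDl addrA subrK.
  rewrite enorm_sqrD.
  have := qform1_le (ltW dlt0) L0 (sqle _ _ (enorm_ge0 _) (ltW dlt0) h1)
    (sqle _ _ (enorm_ge0 _) L0 h2).
  lra.
have emball x : Omega x ->
    (m%:E <= mu ((Omega : set (Rd R n)) `&` [set y | (e (x, y) <= dlt ^+ 2 / 2)%R]))%E.
  move=> Ox; apply: le_trans (mball _ Ox) _; apply: le_measure; rewrite ?inE.
  - apply: measurableI => //.
    have -> : [set y : Rd R n | enorm ((x - y) *m S) <= dlt] =
        [set y : Rd R n | enorm ((x - y) *m S : Rd R n) ^+ 2 <= dlt ^+ 2].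
      by apply/seteqP; split => y /=; rewrite ler_pXn2r ?nnegrE ?enorm_ge0// ltW.
    apply: measurable_sublevel; apply: measurable_enorm_sqr.
    apply: (measurableT_comp (@measurable_mulmx R n S)).
    by apply: measurable_subr.
  - apply: measurableI => //.
    have me1 : measurable_fun setT (fun y : Rd R n => e (x, y)).
      exact: (measurableT_comp me (measurable_pair1 (x : Rd R n))).
    exact: measurable_sublevel me1.
  - move=> y [Oy hy]; split => //=; rewrite eE// /e0 ler_pM2r//.
    by rewrite ler_pXn2r ?nnegrE ?enorm_ge0// ltW.
pose c (z : Rd R n * Rd R n) := e (z.1, U z.2).
have mU2 : measurable_fun setT (fun z : Rd R n * Rd R n => U z.2).
  exact: (measurableT_comp mU measurable_snd).
have mc : measurable_fun setT c.
  by apply: (measurableT_comp me); exact: measurable_fun_pair.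
have nuO : nu (U @^-1` (Omega : set (Rd R n))) = 1%E by rewrite -muU.
have mUO : measurable (U @^-1` (Omega : set (Rd R n))).
  by rewrite -[X in measurable X]setTI; exact: mU.
have half0 (r : R) : 0 <= r ^+ 2 / 2 by rewrite divr_ge0 ?sqr_ge0.
have mhalf (g : Rd R n -> Rd R n) : measurable_fun setT g ->
    measurable_fun setT (fun x => enorm (g x) ^+ 2 / 2).
  by move=> mg; apply: measurable_funM => //; exact: measurable_enorm_sqr.
have mcost : measurable_fun setT (@cost R n).
  apply: measurable_funM => //; apply: measurable_enorm_sqr.
  by apply: measurable_subr; [exact: measurable_fst|exact: measurable_snd].
have bounded_lt d (T : measurableType d) (la : probability T R) (B : set T) (g : T -> R) (M : R) :
    measurable B -> la B = 1%E -> measurable_fun setT g -> (forall t, 0 <= g t) ->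
    (forall t, B t -> g t <= M) -> (\int[la]_t (g t)%:E < +oo)%E.
  move=> mB B1 mg g0 gM.
  have B0 : la (~` B) = 0%E by rewrite probability_setC// B1 subee.
  rewrite (ge0_negligible_integral _ _ _ _ B0)//; last 3 first.
  - exact: measurableC.
  - exact/measurable_EFinP.
  - by move=> t _; rewrite lee_fin.
  rewrite setDE setCK setTI.
  apply: (@le_lt_trans _ _ (\int[la]_(t in B) M%:E)%E).
    apply: ge0_le_integral => //.
    + by move=> t _; rewrite lee_fin.
    + by apply: measurable_funTS; exact/measurable_EFinP.
  rewrite (integral_cst la mB M%:E) [X in (_ * X)%E]B1 mule1; exact: ltry.
have copt g : coupling_density mu nu g ->
    (quadratic_cost mu nu c eps f <= quadratic_cost mu nu c eps g)%E.
  move=> cg.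
  apply: (@quadratic_cost_change _ _ _ _ _ mu nu c cost eps
    (fun x => enorm (x *m S : Rd R n) ^+ 2 / 2 + enorm (x + a : Rd R n) ^+ 2 / 2)
    (fun x => enorm x ^+ 2)
    (fun y => enorm (U y *m S : Rd R n) ^+ 2 / 2)
    (fun y => enorm y ^+ 2 / 2 + enorm a ^+ 2 / 2)
    Omega (U @^-1` Omega) f g) => //.
  - by move=> z; case/andP: (eK (z.1, U z.2)).
  - by move=> z; exact: half0.
  - apply: measurable_funD; apply: mhalf; first exact: measurable_mulmx.
    exact: measurable_translation.
  - exact: measurable_enorm_sqr.
  - by apply: mhalf; apply: (measurableT_comp (@measurable_mulmx R n S)).
  - by apply: measurable_funD => //; exact: mhalf.
  - by move=> x; rewrite addr_ge0.
  - by move=> x; rewrite sqr_ge0.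
  - by move=> y; rewrite addr_ge0.
  - move=> x y Ox Oy; rewrite /c /= eE// /e0 /cost /=.
    by have := affine_cost_identity a x (U y) ST SA; rewrite TU.
  - apply: (bounded_lt _ _ mu Omega _ 1) => //.
    + exact: measurable_enorm_sqr.
    + by move=> x; exact: sqr_ge0.
    + by move=> x Ox; rewrite expr_le1 ?enorm_ge0// Onorm.
  - have [C' C'0 hC'] := enorm_mulmx_bound AT.
    apply: (bounded_lt _ _ nu (U @^-1` Omega) _ (C' + enorm a ^+ 2 + enorm a ^+ 2 / 2)) => //.
    + by apply: measurable_funD => //; exact: mhalf.
    + by move=> y; rewrite addr_ge0.
    + move=> y Oy; rewrite lerD2r -[in leLHS](TU y).
      have h1 := hC' (U y); have h2 := Onorm _ Oy; have h3 := enorm_ge0 (U y).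
      have h4 : enorm (U y) ^+ 2 <= 1 by rewrite expr_le1.
      have h5 : enorm (U y *m A) ^+ 2 <= C' by apply: le_trans h1 _; rewrite ler_piMr// ltW.
      have h6 := enorm_triangle (U y *m A) a; have h7 := enorm_ge0 (U y *m A + a).
      apply: le_trans (half_sqr_le h7 h6) _.
      by rewrite lerD2r.
  - exact: fopt.
have zero := @optimal_density_near_diagonal _ _ (Rd R n) (Rd R n) R mu nu U e
  (Omega : set (Rd R n)) K eps dlt m f mU muU mO O1 me eK K0 esym elip emball m0 dlt0
  mdlt cf copt.
pose D : set (Rd R n * Rd R n) :=
  [set z | [/\ Omega z.1, Omega (U z.2) & (8 * dlt) ^+ 2 / 2 < e (z.1, U z.2)]].
rewrite -/D in zero.
have lamS w : enorm (w *m S) <= Num.sqrt (lambda_max A) * enorm w.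
  exact: enorm_mulmx_sqrt.
rewrite leNgt; apply/negP => far.
set l := Num.sqrt (lambda_max A) in lamS far.
have l0 : 0 <= l by exact: sqrtr_ge0.
set b := enorm (y0 - (x0 *m A + a)) in far.
(* Moving [x0] and [y0] by at most [r] changes the displacement by at most [r * (1 + l * l)], half
   of its excess over the bound. So the product of balls contains only far pairs, apart from the
   null sets [N1] and [N2]. *)
pose r := (b - 8 * l * dlt) / (2 * (1 + l * l)).
have ll : 0 <= l * l by exact: mulr_ge0.
have r0 : 0 < r by rewrite divr_gt0 ?subr_gt0// mulr_gt0//; lra.
have rE : r * (1 + l * l) = (b - 8 * l * dlt) / 2.
  by rewrite /r; field; rewrite gt_eqF//; lra.
pose G := eball x0 r `*` eball y0 r : set (Rd R n * Rd R n).
have mG : measurable G.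
  by apply: measurableX; apply: measurable_eball; exact: ltW.
pose N1 : set (Rd R n * Rd R n) := (~` (Omega : set (Rd R n))) `*` setT.
pose N2 : set (Rd R n * Rd R n) := setT `*` (~` (U @^-1` (Omega : set (Rd R n)))).
have mN1 : measurable N1 by apply: measurableX => //; exact: measurableC.
have mN2 : measurable N2 by apply: measurableX => //; exact: measurableC.
have [cpi _] := plan.
have piN1 : piE N1 = 0%E.
  rewrite /N1; have [-> _] := cpi _ (measurableC mO).
  by rewrite [LHS]probability_setC// [X in (_ - X)%E]O1 subee.
have piN2 : piE N2 = 0%E.
  rewrite /N2; have [_ ->] := cpi _ (measurableC mUO).
  by rewrite [LHS]probability_setC// [X in (_ - X)%E]nuO subee.
have mD : measurable D.
  have -> : D = ((fst @^-1` (Omega : set (Rd R n))) `&`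
      ((fun z : Rd R n * Rd R n => U z.2) @^-1` (Omega : set (Rd R n)))) `&`
      ~` [set z | c z <= (8 * dlt) ^+ 2 / 2].
    apply/seteqP; split => z; rewrite /D /= /c.
      by move=> [? ?]; rewrite ltNge => /negP.
    by move=> [[? ?] /negP]; rewrite -ltNge.
  apply: measurableI; first apply: measurableI.
  - by rewrite -[X in measurable X]setTI; exact: measurable_fst.
  - by rewrite -[X in measurable X]setTI; exact: mU2.
  - by apply: measurableC; exact: measurable_sublevel.
have piD : piE D = 0%E by rewrite fE.
have sub : G `<=` D `|` (N1 `|` N2).
  move=> [x y] [/= hx hy].
  have [Ox|nO] := pselect (Omega x); last by right; left.
  have [Oy|nO] := pselect (Omega (U y)); last by right; right.
  left; split => //=; rewrite eE// /e0.
  have hw : y - (x *m A + a) = - (((x - U y) *m S) *m S).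
    by rewrite -mulmxA SA mulmxBl opprB -[in LHS](TU y) opprD addrACA subrr addr0.
  have h1 := lamS ((x - U y) *m S).
  have h2 : b <= enorm (y - (x *m A + a)) + (r + l * (l * r)).
    have -> : b = enorm ((y - (x *m A + a)) + ((y0 - y) + (((x - x0) *m S) *m S))).
      rewrite /b; congr enorm; rewrite -mulmxA SA mulmxBl.
      by apply/rowP => i; rewrite !mxE; ring.
    apply: le_trans (enorm_triangle _ _) _; rewrite lerD2l.
    apply: le_trans (enorm_triangle _ _) _; apply: lerD; first by rewrite enormB.
    apply: le_trans (lamS _) _; apply: ler_wpM2l => //.
    by apply: le_trans (lamS _) _; apply: ler_wpM2l.
  rewrite hw enormN in h2.
  have h3 : 8 * l * dlt < l * enorm ((x - U y) *m S).
    apply: lt_le_trans h1; have := rE; lra.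
  have lp : 0 < l.
    rewrite lt_neqAle eq_sym l0 andbT; apply/eqP => l00.
    by move: h3; rewrite l00 mulr0 !mul0r ltxx.
  rewrite ltr_pM2r// ltr_pXn2r ?nnegrE ?enorm_ge0//; last by rewrite mulr_ge0// ltW.
  by rewrite -(ltr_pM2l lp); move: h3; rewrite mulrCA mulrA.
have := sxy r r0; rewrite ltNge => /negP; apply => /=.
apply: (@le_trans _ _ (piE (D `|` (N1 `|` N2)))).
  by apply: le_measure; rewrite ?inE//; apply: measurableU => //; exact: measurableU.
rewrite measureU0//; last first.
- apply/eqP; rewrite eq_le measure_ge0 andbT; apply: le_trans (measureU2 _ mN1 mN2) _.
  by rewrite [X in (X + _)%E]piN1 [X in (_ + X)%E]piN2 adde0.
- exact: measurableU.
by rewrite [X in (X <= _)%E]piD.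
Qed.

Unset Implicit Arguments.
Set Strict Implicit.

Theorem theorem3p11 (R : realType) (n : nat)
  (leb : {measure set (Rd R n) -> \bar R}) (Hleb : is_lebesgue leb)
  (mu nu : probability (Rd R n) R)
  (Omega : set 'rV[R]_n.+1) (rho : Rd R n -> R) (lamlo lamhi : R)
  (HOopen : open Omega) (HOconn : connected Omega)
  (HOlip : lipschitz_domain Omega) (HOball : Omega `<=` eball 0 1)
  (Hrho_meas : measurable_fun (Omega : set (Rd R n)) rho)
  (Hmu : forall E : set (Rd R n), measurable E ->
           mu E = (\int[leb]_(x in E `&` Omega) (rho x)%:E)%E)
  (Hlam : 0 < lamlo <= lamhi)
  (Hrho_bd : {ae leb, forall x : Rd R n, Omega x -> lamlo <= rho x <= lamhi})
  (A : 'M[R]_n.+1) (a : 'rV[R]_n.+1) (HA : sym_posdef A)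
  (HT : is_monge_map mu nu (fun x : Rd R n => x *m A + a : Rd R n))
  (S : 'M[R]_n.+1) (HS : sym_posdef S) (HSA : S *m S = A)
  (rA : R) (HrA : 0 < rA) :
  let d := n.+1 in
  let T := fun x : 'rV[R]_n.+1 => x *m A + a in
  let muA := push mu (fun x : Rd R n => x *m S : Rd R n) in
  let OmegaA := [set x *m S | x in Omega] in
  let kappaA := inf [set k : R | exists u r, spt muA u /\ 0 < r <= rA /\
                       k = fine (leb (OmegaA `&` eball u r)) / (omega d * r ^+ d)] in
  let lamA := lamlo / Num.sqrt (\det A) in
  let eps0 := lamA * kappaA * omega d * rA ^+ (d + 2) in
  forall eps : R, 0 < eps <= eps0 ->
  forall piE : {measure set (Rd R n * Rd R n) -> \bar R}, is_reg_ot_plan mu nu eps piE ->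
    (forall x y, spt2 piE (x, y) ->
       enorm (y - T x) <=
         8 * Num.sqrt (lambda_max A) *
           powR (eps / (lamA * kappaA * omega d)) (1 / (d%:R + 2))) /\
    8 * Num.sqrt (lambda_max A) *
      powR (eps / (lamA * kappaA * omega d)) (1 / (d%:R + 2)) =
    8 * Num.sqrt (lambda_max A) *
      powR (Num.sqrt (\det A) * Gamma (d%:R / 2 + 1)
              / (lamlo * kappaA * powR pi (d%:R / 2))) (1 / (d%:R + 2)) *
      powR eps (1 / (d%:R + 2)).
Proof.
move=> d T muA OmegaA kappaA lamA eps0 eps /andP[epspos epsle] piE plan.
have /andP[lamlo0 _] := Hlam; have [ST _] := HS.
have [_ [nuE _]] := HT.
have uS := sym_posdef_unitmx HS; have uA := sym_posdef_unitmx HA.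
have dS0 : \det S != 0 by rewrite -unitfE -unitmxE.
have sqA : Num.sqrt (\det A) = `|\det S| by rewrite -HSA det_mulmx -expr2 sqrtr_sqr.
have sA0 : 0 < Num.sqrt (\det A) by rewrite sqA normr_gt0.
have lamA0 : 0 < lamA by rewrite divr_gt0.
have G0 : 0 <= Gamma (d%:R / 2 + 1) :> R.
  apply: fine_ge0; apply: integral_ge0 => t _.
  by rewrite lee_fin mulr_ge0 ?powR_ge0// expR_ge0.
have om0 : 0 <= omega d :> R by rewrite divr_ge0// powR_ge0.
(* The existence of an admissible [eps] makes [eps0] positive, and positivity of [omega d], [kappaA]
   and [Gamma] follows from it. For [Gamma] the convention for division by zero enters: a zero value
   would make [omega d] vanish. *)
have eps00 : 0 < eps0 by exact: lt_le_trans epsle.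
have lko : 0 < lamA * kappaA * omega d.
  by move: eps00; rewrite pmulr_lgt0// exprn_gt0.
have ko : 0 < kappaA * omega d by move: lko; rewrite -mulrA pmulr_rgt0.
have omp : 0 < omega d :> R.
  rewrite lt_neqAle eq_sym om0 andbT; apply/eqP => E.
  by move: ko; rewrite E mulr0 ltxx.
have kp : 0 < kappaA by move: ko; rewrite pmulr_lgt0.
have Gp : 0 < Gamma (d%:R / 2 + 1) :> R.
  rewrite lt_neqAle eq_sym G0 andbT; apply/eqP => E.
  by move: omp; rewrite /omega E invr0 mulr0 ltxx.
have pip : 0 < powR (pi : R) (d%:R / 2) by rewrite powR_gt0// pi_gt0.
set P := lamA * kappaA * omega d in lko *.
set dlt := powR (eps / P) (1 / (d%:R + 2)).
have d2 : d%:R + 2 = (d + 2)%:R :> R by rewrite natrD.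
have dlt0 : 0 < dlt by rewrite powR_gt0// divr_gt0.
have dltE : dlt ^+ (d + 2) = eps / P.
  by rewrite /dlt d2 powR_root ?addn2// divr_ge0// ltW.
split; last first.
  rewrite -[RHS]mulrA -powRM; last 2 first.
  - by rewrite divr_ge0// ?mulr_ge0// ltW.
  - exact: ltW.
  congr (_ * powR _ _); rewrite /P /lamA /omega; field.
  by rewrite !gt_eqF.
move=> x y sxy.
(* This is the hypothesis [eps <= eps0] raised to the power [1 / (d + 2)]; it makes the radius [dlt]
   admissible in [kappaA]. *)
have dltr : dlt <= rA.
  rewrite -(@ler_pXn2r _ (d + 2)) ?addn2// ?nnegrE; last 2 first.
  - exact: ltW.
  - exact: ltW.
  by rewrite -addn2 dltE ler_pdivrMr// mulrC.
have mO : measurable (Omega : set (Rd R n)) by exact: measurable_open.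
have O1 : mu (Omega : set (Rd R n)) = 1%E.
  have := probability_setT mu; rewrite (Hmu _ measurableT) setTI => <-.
  by rewrite Hmu// setIid.
have lb (E : set (Rd R n)) : measurable E -> (lamlo%:E * leb (E `&` Omega) <= mu E)%E.
  by move=> mE; exact: (density_lower_bound HOopen Hrho_meas Hmu lamlo0 Hrho_bd mE).
apply: (@affine_plan_support R n mu nu Omega A S a eps dlt (P * dlt ^+ d) piE) => //.
- by rewrite mulr_gt0// exprn_gt0.
- by rewrite -mulrA -exprD dltE mulrC divfK// gt_eqF.
move=> z Oz.
have kz : kappaA <= fine (leb (OmegaA `&` eball (z *m S) dlt)) / (omega d * dlt ^+ d).
  apply: ge_inf.
    exists 0 => _ [u [r [_ [/andP[r0 _] ->]]]].
    by rewrite divr_ge0 ?fine_ge0// mulr_ge0// exprn_ge0// ltW.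
  exists (z *m S), dlt; split; last by rewrite dlt0 dltr.
  exact: (spt_pushforward Hleb HOopen lamlo0 ST lb Oz).
have hk : kappaA * (omega d * dlt ^+ d) <= fine (leb (OmegaA `&` eball (z *m S) dlt)).
  by rewrite -ler_pdivlMr// mulr_gt0// exprn_gt0.
have := pushforward_ball_mass Hleb HOopen (ltW lamlo0) uS (ltW dlt0) lb hk.
have -> : lamlo / `|\det S| * (kappaA * (omega d * dlt ^+ d)) = P * dlt ^+ d.
  by rewrite /P /lamA sqA !mulrA.
exact.
Qed.
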